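(* For $\alpha=(\alpha_1,\dots,\alpha_d)\in\mathbb{R}^{H\times d}$ put $\psi_k(y)=\sum_{h=1}^H\alpha_{h,k}\mathds{1}_{\{y\in I(h)\}}$, $\eta_k=\mathbb{E}[Z\psi_k(Y)]$, $\eta=(\eta_1,\dots,\eta_d)\in\mathbb{R}^{p\times d}$, $\widehat\eta_k=\frac1n\sum_{i=1}^nZ_i\psi_k(Y_i)$, $\widehat\eta=(\widehat\eta_1,\dots,\widehat\eta_d)$, and let $\widehat P_n=\widehat\eta(\widehat\eta^T\widehat\eta)^{-1}\widehat\eta^T$ be the orthogonal projection on the span of $\widehat\eta$. For $\alpha$ satisfying $\eta^T\eta=I_d$, the random variable $n\operatorname{tr}(Q_c\widehat P_n)$ has a limit in law $W_\alpha$ as $n\to\infty$. The minimization problem $$\min_{\alpha}\ \mathbb{E}[W_\alpha]\quad\text{under the constraint}\quad \eta^T\eta=I_d$$ has a unique solution, up to orthogonal transformations (i.e. up to right multiplication of $\alpha$ by an orthogonal $d\times d$ matrix), given by $$\alpha=D^{-\frac12}P_1D_0^{-\frac12}.$$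
   Context: $Y$ is a real random variable, $X$ a random vector in $\mathbb{R}^p$ with invertible covariance matrix $\Sigma$, and $Z=\Sigma^{-1/2}(X-\mathbb{E}[X])$, so $\mathbb{E}[Z]=0$ and $\operatorname{var}(Z)=I$; $(Z_i,Y_i)_{i\ge1}$ are i.i.d. copies of $(Z,Y)$. A dimension reduction subspace (DRS) for $Z$ is a linear subspace $E\subset\mathbb{R}^p$ such that $Y$ and $Z$ are conditionally independent given $PZ$, $P$ being the orthogonal projection on $E$. The (standardized) central subspace $E_c$ is the unique DRS of minimal dimension, equal to the intersection of all DRS. Standing assumptions: $X$ has a density whose support has a boundary of Lebesgue measure $0$, and $E_c$ exists; the linearity condition $Q_c\mathbb{E}[Z|P_cZ]=0$ a.s. holds, where $P_c$ is the orthogonal projection on $E_c$ and $Q_c=I-P_c$. $d=\dim E_c$ is known. The range of $Y$ is partitioned into $H$ slices $I(1),\dots,I(H)$. Define $C=(C_1,\dots,C_H)\in\mathbb{R}^{p\times H}$ with $C_h=\mathbb{E}[Z\mathds{1}_{\{Y\in I(h)\}}]$, $D=\operatorname{diag}(d_1,\dots,d_H)$ with $d_h=\mathbb{E}[\|Q_cZ\|^2\mathds{1}_{\{Y\in I(h)\}}]>0$, and $G=D^{-1/2}C^TCD^{-1/2}\in\mathbb{R}^{H\times H}$. The slices are such that the vectors $C_1,\dots,C_H$ span $E_c$, so $G$ has rank $d$. $P=(P_1\,P_2)$, with $P_1\in\mathbb{R}^{H\times d}$ and $P_2\in\mathbb{R}^{H\times(H-d)}$, is an orthogonal matrix such that $P^TGP=\begin{pmatrix}D_0&0\\0&0\end{pmatrix}$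 with $D_0\in\mathbb{R}^{d\times d}$ the diagonal matrix of nonzero eigenvalues of $G$. $\mathds{1}$ denotes an indicator function. *)

(* Defs.v *)
From HB Require Import structures.
From mathcomp Require Import all_boot all_order all_algebra.
From mathcomp Require Import all_classical all_reals all_analysis.

Set Implicit Arguments.
Unset Strict Implicit.
Unset Printing Implicit Defensive.

Import Order.TTheory GRing.Theory Num.Theory.
Import numFieldNormedType.Exports.

Local Open Scope classical_set_scope.
Local Open Scope ring_scope.

Section mx_measurable_structure.
Context (R : realType) (m n : nat).

Definition mx_coord_sets : set (set 'M[R]_(m, n)) :=
  \bigcup_(ij in [set: 'I_m * 'I_n])
    preimage_set_system setT (fun M : 'M[R]_(m, n) => M ij.1 ij.2) measurable.

Definition mx_measurable : set (set 'M[R]_(m, n)) := <<s mx_coord_sets >>.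

Let mx_measurable0 : mx_measurable set0.
Proof. exact: sigma_algebra0. Qed.

Let mx_measurableC A : mx_measurable A -> mx_measurable (~` A).
Proof. exact: sigma_algebraC. Qed.

Let mx_measurable_bigcup (F : (set 'M[R]_(m, n))^nat) :
  (forall i, mx_measurable (F i)) -> mx_measurable (\bigcup_i F i).
Proof. exact: sigma_algebra_bigcup. Qed.

HB.instance Definition _ := @isMeasurable.Build default_measure_display
  'M[R]_(m, n) mx_measurable mx_measurable0 mx_measurableC mx_measurable_bigcup.

Lemma measurable_coord i j :
  measurable_fun setT (fun M : 'M[R]_(m, n) => M i j : R).
Proof.
move=> _ B mB; apply: sub_sigma_algebra; exists (i, j) => //=.
by exists B.
Qed.

Lemma measurable_fun_mx d (T : measurableType d) (f : T -> 'M[R]_(m, n)) :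
  (forall i j, measurable_fun setT (fun t => f t i j : R)) ->
  measurable_fun setT f.
Proof.
move=> mf.
have E : @measurable _ 'M[R]_(m, n) = <<s mx_coord_sets >> by [].
apply: (@measurability _ _ _ _ setT f _ E).
move=> _ [_ [[i j] _ [B mB <-]] <-].
by have := mf i j measurableT B mB; rewrite !setTI.
Qed.

End mx_measurable_structure.

Section lebesgue_cV.
Context (R : realType).

Definition cons_cV p (xv : R * 'cV[R]_p) : 'cV[R]_p.+1 :=
  col_mx (xv.1%:M : 'cV[R]_1) xv.2.

Definition uncons_cV p (v : 'cV[R]_p.+1) : R * 'cV[R]_p :=
  (v ord0 0, dsubmx (v : 'cV[R]_(1 + p))).

Lemma cons_cVK p : cancel (@cons_cV p) (@uncons_cV p).
Proof.
case=> x v; rewrite /uncons_cV /cons_cV /= col_mxKd; congr pair.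
rewrite (_ : ord0 = lshift p (ord0 : 'I_1)); last exact/val_inj.
by rewrite (col_mxEu (x%:M : 'M[R]_1)) mxE eqxx.
Qed.

Lemma measurable_cons_cV p : measurable_fun setT (@cons_cV p).
Proof.
apply: measurable_fun_mx => i j; rewrite (ord1 j).
rewrite (_ : (fun t => _) =
    fun t : R * 'cV[R]_p => if fintype.split (i : 'I_(1 + p)) is inr k then t.2 k 0 else t.1).
  case: fintype.split => [_|k]; first exact: measurable_fst.
  exact: (measurableT_comp (measurable_coord _ _) measurable_snd).
apply/funext => t; rewrite /cons_cV mxE.
by case: fintype.split => // k; rewrite mxE (ord1 k) eqxx.
Qed.

Lemma measurable_uncons_cV p : measurable_fun setT (@uncons_cV p).
Proof.
apply: measurable_fun_pair; first exact: measurable_coord.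
apply: measurable_fun_mx => i j.
rewrite (_ : (fun t => _) = fun t : 'cV[R]_p.+1 => t (rshift 1 i) j).
  exact: measurable_coord.
by apply/funext => t; rewrite mxE.
Qed.

Section step.
Context (p : nat) (mu : {sigma_finite_measure set 'cV[R]_p -> \bar R}).

Definition lebesgue_cons : set 'cV[R]_p.+1 -> \bar R :=
  pushforward (@lebesgue_measure R \x mu)%E (@cons_cV p).

Let lebesgue_cons0 : lebesgue_cons set0 = 0%E.
Proof. by rewrite /lebesgue_cons /pushforward preimage_set0 measure0. Qed.

Let lebesgue_cons_ge0 A : (0 <= lebesgue_cons A)%E.
Proof. by rewrite /lebesgue_cons /pushforward measure_ge0. Qed.

Let lebesgue_cons_sigma_additive : semi_sigma_additive lebesgue_cons.
Proof.
move=> F mF tF mUF; rewrite /lebesgue_cons /pushforward preimage_bigcup.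
apply: measure_semi_sigma_additive.
- by move=> n; rewrite -[X in measurable X]setTI; exact: measurable_cons_cV.
- by move=> i j _ _ [x [Fi Fj]]; apply: tF => //; exists (cons_cV x).
- rewrite -preimage_bigcup -[X in measurable X]setTI.
  exact: measurable_cons_cV.
Qed.

HB.instance Definition _ := isMeasure.Build _ _ _ lebesgue_cons
  lebesgue_cons0 lebesgue_cons_ge0 lebesgue_cons_sigma_additive.

Let lebesgue_cons_sigma_finite : sigma_finite setT lebesgue_cons.
Proof.
have /sigma_finiteP[F [TF ndF Foo]] := sigma_finiteT (@lebesgue_measure R).
have /sigma_finiteP[G [TG ndG Goo]] := sigma_finiteT mu.
exists (fun k => @uncons_cV p @^-1` (F k `*` G k)).
  rewrite -preimage_bigcup (_ : \bigcup_k _ = setT) ?preimage_setT//.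
  rewrite predeqE => -[x y]; split=> // _.
  have [n _ Fnx] : (\bigcup_k F k) x by rewrite -TF.
  have [k _ Gky] : (\bigcup_k G k) y by rewrite -TG.
  exists (maxn n k) => //; split.
  - by move: x Fnx; exact/subsetPset/ndF/leq_maxl.
  - by move: y Gky; exact/subsetPset/ndG/leq_maxr.
move=> k; have [mF Fk] := Foo k; have [mG Gk] := Goo k.
have mFG : measurable (F k `*` G k) by exact: measurableX.
split; first by rewrite -[X in measurable X]setTI; exact: measurable_uncons_cV.
rewrite /lebesgue_cons /pushforward (_ : _ @^-1` _ = F k `*` G k).
  by rewrite product_measure1E// lte_mul_pinfty// ge0_fin_numE.
rewrite -comp_preimage (_ : _ \o _ = id) ?preimage_id//.
by apply/funext => x; exact: cons_cVK.
Qed.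

HB.instance Definition _ := Measure_isSigmaFinite.Build _ _ _ lebesgue_cons
  lebesgue_cons_sigma_finite.

End step.

Fixpoint lebesgue_cV p : {sigma_finite_measure set 'cV[R]_p -> \bar R} :=
  match p with
  | 0 => dirac (0 : 'cV[R]_0)
  | p'.+1 => lebesgue_cons (lebesgue_cV p')
  end.

End lebesgue_cV.

Section linear_algebra.
Context (R : realType).

(* Equal to the orthogonal projection on the column span of B when the columns
   of B are linearly independent; [invmx M] is [M] when M is singular. *)
Definition colproj p k (B : 'M[R]_(p, k)) : 'M[R]_p :=
  B *m invmx (B^T *m B) *m B^T.

Definition basis_mx p (E : {vspace 'cV[R]_p}) : 'M[R]_(p, \dim E) :=
  \matrix_(i, j) tnth (vbasis E) j i 0.

Definition orthproj p (E : {vspace 'cV[R]_p}) : 'M[R]_p :=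
  colproj (basis_mx E).

Definition sqnorm p (v : 'cV[R]_p) : R := \sum_i v i 0 ^+ 2.

Definition orthogonal_mx n (O : 'M[R]_n) : Prop :=
  O^T *m O = 1%:M /\ O *m O^T = 1%:M.

(* S = M^{1/2} *)
Definition is_psd_sqrt n (M S : 'M[R]_n) : Prop :=
  [/\ S^T = S, forall v : 'cV[R]_n, 0 <= (v^T *m S *m v) 0 0 & S *m S = M].

(* diag(v)^{-1/2} *)
Definition diag_invsqrt n (v : 'rV[R]_n) : 'M[R]_n :=
  diag_mx (map_mx (fun x => (Num.sqrt x)^-1) v).

Lemma basis_mx_mulmx p (E : {vspace 'cV[R]_p}) (c : 'cV[R]_(\dim E)) :
  basis_mx E *m c = \sum_j c j 0 *: tnth (vbasis E) j.
Proof.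
apply/colP => i; rewrite mxE summxE; apply: eq_bigr => j _.
by rewrite !mxE mulrC.
Qed.

Lemma mulmx_tr_eq0 p (v : 'cV[R]_p) : v^T *m v = 0 -> v = 0.
Proof.
move=> /matrixP/(_ 0 0); rewrite !mxE => /eqP.
rewrite psumr_eq0 => [/allP v0|i _]; last by rewrite mxE -expr2 sqr_ge0.
apply/colP => i; have := v0 i (mem_index_enum _).
by rewrite !mxE -expr2 sqrf_eq0 => /eqP.
Qed.

Lemma basis_mx_unit p (E : {vspace 'cV[R]_p}) :
  (basis_mx E)^T *m basis_mx E \in unitmx.
Proof.
set B := basis_mx E; rewrite -unitmx_tr -row_free_unit -kermx_eq0.
apply/rowV0P => v /sub_kermxP; rewrite trmx_mul trmxK => vB.
have Bv0 : B *m v^T = 0.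
  apply: mulmx_tr_eq0; rewrite trmx_mul trmxK.
  by rewrite -mulmxA (mulmxA B^T) mulmxA -mulmxA mulmxA vB mul0mx.
have /freeP fr : free (vbasis E) := basis_free (vbasisP E).
apply/rowP => j; rewrite mxE.
move: Bv0; rewrite basis_mx_mulmx => Bv0.
have := fr (fun j => v 0 j); move=> /(_ _ j) <-//.
rewrite -[RHS]Bv0; apply: eq_bigr => k _.
by rewrite mxE (tnth_nth 0).
Qed.

(* [orthproj E] is the orthogonal projection on E. *)
Lemma orthprojP p (E : {vspace 'cV[R]_p}) :
  [/\ (orthproj E)^T = orthproj E, orthproj E *m orthproj E = orthproj E &
      forall x, (x \in E) = (orthproj E *m x == x)].
Proof.
have uB := basis_mx_unit E; rewrite /orthproj /colproj.
set B := basis_mx E in uB *.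
split.
- by rewrite !trmx_mul trmxK trmx_inv trmx_mul trmxK mulmxA.
- rewrite -!mulmxA; congr (B *m (_ *m _)).
  by rewrite (mulmxA B^T) mulmxA mulmxV// mul1mx.
- move=> x; apply/idP/eqP => [xE|<-].
    have -> : x = B *m \col_j coord (vbasis E) j x.
      rewrite basis_mx_mulmx {1}(coord_vbasis xE).
      by apply: eq_bigr => j _; rewrite mxE (tnth_nth 0).
    by rewrite -!mulmxA (mulmxA B^T) (mulmxA (invmx _)) mulVmx// mul1mx.
  rewrite -!mulmxA basis_mx_mulmx memv_suml// => j _.
  by rewrite memvZ// vbasis_mem// mem_tnth.
Qed.

End linear_algebra.

Section probability_notions.
Context d (T : measurableType d) (R : realType) (P : probability T R).

Definition sigma_of d' (S : measurableType d') (W : T -> S) : set (set T) :=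
  preimage_set_system setT W measurable.

(* V is a version of E[U | G] for the sub-sigma-algebra G. *)
Definition is_cond_expectation (G : set (set T)) (U V : T -> R) : Prop :=
  [/\ forall B : set R, measurable B -> G (V @^-1` B),
      P.-integrable setT (EFin \o V) &
      forall A, G A ->
        (\int[P]_(w in A) (V w)%:E = \int[P]_(w in A) (U w)%:E)%E].

Definition cond_independent d1 d2 d3 (S1 : measurableType d1)
    (S2 : measurableType d2) (S3 : measurableType d3)
    (U : T -> S1) (V : T -> S2) (W : T -> S3) : Prop :=
  forall (A : set S1) (B : set S2), measurable A -> measurable B ->
  exists f g : T -> R,
    [/\ is_cond_expectation (sigma_of W) \1_(U @^-1` A) f,
        is_cond_expectation (sigma_of W) \1_(V @^-1` B) g &
        is_cond_expectation (sigma_of W) \1_(U @^-1` A `&` V @^-1` B)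
          (f \* g)].

Definition iid_copies d' (S : measurableType d') (U : nat -> T -> S)
    (V : T -> S) : Prop :=
  (forall (J : seq nat) (B : nat -> set S), uniq J ->
     (forall i, measurable (B i)) ->
     P (\bigcap_(i in [set` J]) (U i @^-1` B i)) =
     (\prod_(i <- J) P (U i @^-1` B i))%E) /\
  (forall i (B : set S), measurable B -> P (U i @^-1` B) = P (V @^-1` B)).

Definition cvg_in_law (W : nat -> T -> R)
    (law : probability (measurableTypeR R) R) : Prop :=
  forall f : R -> R, continuous f -> (exists M, forall x, `|f x| <= M) ->
    'E_P[f \o W n]%E @[n --> \oo] --> (\int[law]_x (f x)%:E)%E.

Definition law_mean (law : probability (measurableTypeR R) R) : \bar R :=
  (\int[law]_x (x : R)%:E)%E.

Definition mean_cV p (X : T -> 'cV[R]_p) : 'cV[R]_p :=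
  \col_i fine 'E_P[fun w => X w i 0].

Definition cov_mx p (X : T -> 'cV[R]_p) : 'M[R]_p :=
  \matrix_(i, j) fine (covariance P (fun w => X w i 0) (fun w => X w j 0)).

(* Z = S (X - E[X]); the standardized vector when S = Sigma^{-1/2}. *)
Definition standardize p (S : 'M[R]_p) (X : T -> 'cV[R]_p) : T -> 'cV[R]_p :=
  fun w => S *m (X w - mean_cV X).

(* X has a density whose support (the closure of the set where it is nonzero)
   has a Lebesgue-null boundary. *)
Definition has_density_null_boundary p (X : T -> 'cV[R]_p) : Prop :=
  exists f : 'cV[R]_p -> R,
    let supp := closure [set x | f x != 0] in
    [/\ measurable_fun setT f, forall x, 0 <= f x,
        forall A, measurable A ->
          P (X @^-1` A) = (\int[lebesgue_cV R p]_(x in A) (f x)%:E)%E &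
        lebesgue_cV R p (closure supp `\` interior supp) = 0%E].

Definition is_DRS p (Y : T -> R) (Z : T -> 'cV[R]_p)
    (E : {vspace 'cV[R]_p}) : Prop :=
  cond_independent Y Z (fun w => orthproj E *m Z w).

Definition is_central_subspace p (Y : T -> R) (Z : T -> 'cV[R]_p)
    (E : {vspace 'cV[R]_p}) : Prop :=
  [/\ is_DRS Y Z E,
      forall F, is_DRS Y Z F -> (\dim E <= \dim F)%N,
      forall F, is_DRS Y Z F -> \dim F = \dim E -> F = E &
      forall x, x \in E <-> (forall F, is_DRS Y Z F -> x \in F)].

(* Q E[Z | Pr Z] = 0 a.s. with Q = I - Pr *)
Definition linearity_condition p (Z : T -> 'cV[R]_p) (Pr : 'M[R]_p) : Prop :=
  exists2 M : T -> 'cV[R]_p,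
    forall i, is_cond_expectation (sigma_of (fun w => Pr *m Z w))
                (fun w => Z w i 0) (fun w => M w i 0) &
    {ae P, forall w, (1%:M - Pr) *m M w = 0}.

End probability_notions.

Section slicing.
Context d (T : measurableType d) (R : realType) (P : probability T R).
Context (p H k : nat) (I : 'I_H -> set R).

Definition slice_C (Y : T -> R) (Z : T -> 'cV[R]_p) : 'M[R]_(p, H) :=
  \matrix_(i, h) fine 'E_P[fun w => Z w i 0 * \1_(I h) (Y w)].

(* (d_1, ..., d_H), where Q is meant to be Q_c *)
Definition slice_d (Y : T -> R) (Z : T -> 'cV[R]_p) (Q : 'M[R]_p) : 'rV[R]_H :=
  \row_h fine 'E_P[fun w => sqnorm (Q *m Z w) * \1_(I h) (Y w)].

Definition slice_G (C : 'M[R]_(p, H)) (dv : 'rV[R]_H) : 'M[R]_H :=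
  diag_invsqrt dv *m C^T *m C *m diag_invsqrt dv.

Definition slice_psi (alpha : 'M[R]_(H, k)) (j : 'I_k) (y : R) : R :=
  \sum_h alpha h j * \1_(I h) y.

Definition eta_mx (Y : T -> R) (Z : T -> 'cV[R]_p) (alpha : 'M[R]_(H, k)) :
    'M[R]_(p, k) :=
  \matrix_(i, j) fine 'E_P[fun w => Z w i 0 * slice_psi alpha j (Y w)].

Definition eta_hat_mx (Ys : nat -> T -> R) (Zs : nat -> T -> 'cV[R]_p)
    (alpha : 'M[R]_(H, k)) (n : nat) (w : T) : 'M[R]_(p, k) :=
  \matrix_(i, j) (n%:R^-1 * \sum_(m < n) Zs m w i 0 * slice_psi alpha j (Ys m w)).

Definition trace_stat (Ys : nat -> T -> R) (Zs : nat -> T -> 'cV[R]_p)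
    (Q : 'M[R]_p) (alpha : 'M[R]_(H, k)) (n : nat) (w : T) : R :=
  n%:R * \tr (Q *m colproj (eta_hat_mx Ys Zs alpha n w)).

End slicing.

(* Main.v *)
Require Import Defs.
From HB Require Import structures.
From mathcomp Require Import all_boot all_order all_algebra.
From mathcomp Require Import all_classical all_reals all_analysis.
From mathcomp Require Import measurable_realfun ring lra.

Set Implicit Arguments.
Unset Strict Implicit.
Unset Printing Implicit Defensive.

Import Order.TTheory GRing.Theory Num.Theory.
Import numFieldNormedType.Exports.

Local Open Scope classical_set_scope.
Local Open Scope ring_scope.

(* For feasible alpha the residual Q_c eta vanishes, so n tr(Q_c P_n) equals
   |sqrt n Q_c eta_hat|^2 up to a relative error that tends to 0 in probability
   (eta_hat^T eta_hat is close to 1).  The central limit theorem makes the limit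
   law a quadratic form in Gaussian variables whose mean is
   sum_k E[|Q_c Z|^2 psi_k(Y)^2] = |D^(1/2) alpha|^2 (Frobenius norm).  With
   b = D^(1/2) alpha the constraint reads (D0^(1/2) P1^T b) orthogonal, so P1^T b
   has the fixed norm tr(D0^-1) and the cost is minimal exactly when P2^T b = 0.

   The central limit theorem is needed only for the squared norm of a normalized
   sum S_n.  Its Laplace transform is obtained from one-dimensional cosine
   transforms, exp(-s |x|^2) = E cos(sqrt(2 s) <x, N>) with N standard Gaussian,
   and Laplace transforms together with bounded means determine convergence in
   law of nonnegative variables, by the Weierstrass theorem in exp(-x). *)

(** Only second moments of Z are available, and the limit law is arbitrary among those satisfying
    the definition. The error of replacing (eta_hat^T eta_hat)^-1 by 1 is therefore bounded relative
    to n |Q_c eta_hat|^2, whose mean is the same for all n >= 1 because Q_c Z psi_k(Y) is centred;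
    Markov's inequality with that one constant then cuts all tails. The Gaussian vector plays two
    roles: it is the integration variable that linearizes exp(-s |x|^2), and through the quadratic
    form v |-> E <v, b>^2 it carries the limit law, so that no square root of a covariance matrix is
    constructed. Means need not pass to the limit under convergence in law; the mean of the limit is
    computed from this representation, and equality of the integrals of bounded continuous functions
    transfers it to any other limit law. Q_c eta vanishes because eta = C alpha and every column of
    C lies in E_c. The weights d_h enter because the slices are disjoint, so that psi_k^2 = sum_h
    alpha_(h,k)^2 1_(I h). *)

Lemma cvgr0_le_harmonic (R : realType) (u : nat -> R) (K : R) :
  (forall n, `|u n| <= K / n.+1%:R) -> u n @[n --> \oo] --> (0 : R).
Proof.
move=> uK; have cv : K * harmonic n @[n --> \oo] --> (0 : R).
  by rewrite -[X in _ --> X](mulr0 K); apply: cvgMr; exact: cvg_harmonic.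
apply: (@squeeze_cvgr _ _ _ _ (fun n => - (K * harmonic n)) (fun n => K * harmonic n)) => //.
- by apply: nearW => n; rewrite -ler_norml uK.
- by rewrite -[X in _ --> X]oppr0; exact: cvgN.
Qed.

(** * Dominated convergence and integrability for real-valued integrals *)

Section Rintegral_lemmas.
Context d (T : measurableType d) (R : realType).

Lemma dominated_cvg_Rintegral (mu : {measure set T -> \bar R})
    (f_ : nat -> T -> R) (f g : T -> R) :
  (forall n, measurable_fun setT (f_ n)) ->
  (forall x, f_ n x @[n --> \oo] --> f x) ->
  mu.-integrable setT (EFin \o g) ->
  (forall n x, `|f_ n x| <= g x) ->
  mu.-integrable setT (EFin \o f) /\
  \int[mu]_x f_ n x @[n --> \oo] --> \int[mu]_x f x.
Proof.
move=> mf_ cf ig fg.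
have mf : measurable_fun setT f.
  by apply: (measurable_fun_cvg mf_) => x _; exact: cf.
have [||||fi _ cv] := @dominated_convergence _ _ _ mu setT measurableT
  (fun n => EFin \o f_ n) (EFin \o f) (EFin \o g) _ _ _ ig _.
- by move=> n; exact/measurable_EFinP.
- exact/measurable_EFinP.
- by apply: aeW => x _; apply: cvg_EFin; [exact: nearW|exact: cf].
- by apply: aeW => x n _ /=; rewrite lee_fin.
split=> //; apply: fine_cvg; rewrite fineK; last exact: integrable_fin_num.
exact: cv.
Qed.

Lemma integrable_bounded (mu : {finite_measure set T -> \bar R}) (f : T -> R)
    (M : R) :
  measurable_fun setT f -> (forall x, `|f x| <= M) ->
  mu.-integrable setT (EFin \o f).
Proof.
move=> mf fM; apply: measurable_bounded_integrable => //.
  by rewrite ltey_eq fin_num_measure.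
by exists M; split; [exact: num_real|move=> x Mx y _; exact: le_trans (ltW Mx)].
Qed.

End Rintegral_lemmas.

(** * The standard normal law: Stein's identity, moments, cosine transform *)

Section normal_integral.
Context {R : realType}.
Notation gauss := (normal_prob (0 : R) 1).
Notation mu := (@lebesgue_measure R).
Notation pdf := (normal_pdf (0 : R) 1).

(** The Radon-Nikodym derivative of [normal_prob m s] and the function [normal_pdf m s] have the
    same integral over every measurable set, hence agree almost everywhere; the change of variables
    known for the former then holds for the latter. *)
Lemma ge0_integral_normal (m s : R) (f : R -> \bar R) :
  measurable_fun setT f -> (forall x, (0 <= f x)%E) ->
  (\int[normal_prob m s]_x f x = \int[mu]_x (f x * (normal_pdf m s x)%:E))%E.
Proof.
move=> mf f0.
pose nu : {finite_measure set _ -> \bar R} := normal_prob m s.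
have dom : nu `<< mu by exact: normal_prob_dominates.
have mE := @measurableT _ (measurableTypeR R).
rewrite -(Radon_Nikodym_SigmaFinite.change_of_variables dom f0 mE mf).
have ii := Radon_Nikodym_SigmaFinite.f_integrable dom.
have mpdf : measurable_fun setT (EFin \o normal_pdf m s).
  by apply/measurable_EFinP; exact: measurable_normal_pdf.
apply: ae_eq_integral => //.
- by apply: emeasurable_funM => //; exact: measurable_int ii.
- by apply: emeasurable_funM.
- apply: ae_eqe_mul2l; apply: integral_ae_eq => // E _ mE'.
  by rewrite -Radon_Nikodym_SigmaFinite.f_integral.
Qed.

Lemma integrable_normal (m s : R) (f : R -> R) : measurable_fun setT f ->
  mu.-integrable setT (fun x => (f x * normal_pdf m s x)%:E) ->
  (normal_prob m s).-integrable setT (EFin \o f).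
Proof.
move=> mf /integrableP[_ fi]; apply/integrableP; split.
  exact/measurable_EFinP.
rewrite ge0_integral_normal//; last first.
  by apply: measurableT_comp => //; exact/measurable_EFinP.
rewrite (_ : integral _ _ _ =
  (\int[mu]_x `|(f x * normal_pdf m s x)%:E|)%E)//; apply: eq_integral => x _ /=.
by rewrite normrM EFinM (ger0_norm (normal_pdf_ge0 _ _ _)).
Qed.

Lemma integral_normal (m s : R) (f : R -> R) : measurable_fun setT f ->
  mu.-integrable setT (fun x => (f x * normal_pdf m s x)%:E) ->
  (\int[normal_prob m s]_x (f x)%:E =
   \int[mu]_x (f x * normal_pdf m s x)%:E)%E.
Proof.
move=> mf fi; have mf' : measurable_fun setT (EFin \o f).
  exact/measurable_EFinP.
rewrite integralE [RHS]integralE !ge0_integral_normal//;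
  [|exact: measurable_funeneg|exact: measurable_funepos].
congr (_ - _)%E; apply: eq_integral => x _.
  by rewrite !funeposE -!EFin_max -EFinM maxr_pMl ?normal_pdf_ge0// mul0r.
by rewrite !funenegE -!EFinN -!EFin_max -EFinM maxr_pMl ?normal_pdf_ge0// mul0r mulNr.
Qed.

Let pdfE x : pdf x = normal_peak 1 * expR (- (x ^+ 2 / 2)).
Proof.
by rewrite normal_pdfE ?oner_eq0// /normal_fun subr0 expr1n mulNr.
Qed.

Let is_derive_pdf (x : R) : is_derive x 1 pdf (- x * pdf x).
Proof.
have -> : pdf = (fun x => normal_peak 1 * expR (- (x ^+ 2 / 2))).
  by apply/funext => y; rewrite pdfE.
apply: is_derive_eq.
by rewrite !scaler0 ?add0r /GRing.scale/=; field.
Qed.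

(** Up to a constant, the normal density of variance 2. The standard density is a multiple of
    [w x * w x]: one factor absorbs quadratic growth, the other stays as an integrable envelope. *)
Let w (x : R) := expR (- (x ^+ 2 / 4)).

Let integrable_w : mu.-integrable setT (EFin \o w).
Proof.
have s2 : Num.sqrt 2 != 0 :> R by rewrite gt_eqF// sqrtr_gt0.
have := integrableZl measurableT ((normal_peak (Num.sqrt 2 : R))^-1)
  (integrable_normal_pdf 0 (Num.sqrt 2 : R)).
apply: eq_integrable => // x _.
rewrite normal_pdfE// /normal_fun subr0 -EFinM mulKf ?gt_eqF ?normal_peak_gt0//.
rewrite /w /= sqr_sqrtr//; congr (expR _)%:E.
by rewrite mulNr; congr (- (_ / _)); rewrite -mulr_natr -natrM.
Qed.

(** The constant 4 comes from expR (x^2 / 4) >= 1 + x^2 / 4, that is 1 + x^2 <= 4 expR (x^2 / 4). *)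
Let pdf_dominated x : (1 + x ^+ 2) * pdf x <= 4 * normal_peak 1 * w x.
Proof.
rewrite pdfE mulrCA [leRHS](_ : _ = normal_peak 1 * (4 * w x)); last by ring.
rewrite ler_wpM2l ?normal_peak_ge0//.
have -> : expR (- (x ^+ 2 / 2)) = w x * w x.
  by rewrite /w -expRD; congr expR; field.
rewrite mulrA ler_wpM2r ?expR_ge0// /w expRN ler_pdivrMr ?expR_gt0//.
by have := expR_ge1Dx (x ^+ 2 / 4); lra.
Qed.

Let integrable_pdf_dominated (f : R -> R) (K : R) : measurable_fun setT f ->
  (forall x, `|f x| <= K * (1 + x ^+ 2)) ->
  mu.-integrable setT (fun x => (f x * pdf x)%:E).
Proof.
move=> mf fK; have := integrableZl measurableT (K * (4 * normal_peak 1)) integrable_w.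
apply: le_integrable => //.
  apply/measurable_EFinP/measurable_funM => //; exact: measurable_normal_pdf.
move=> x _ /=; rewrite lee_fin normrM (ger0_norm (normal_pdf_ge0 _ _ _)).
apply: le_trans (ler_norm _); rewrite -mulrA.
apply: (@le_trans _ _ (K * ((1 + x ^+ 2) * pdf x))).
  by rewrite mulrA ler_wpM2r ?normal_pdf_ge0.
rewrite ler_wpM2l ?pdf_dominated//.
have := fK 0; rewrite expr0n /= addr0 mulr1; apply: le_trans; exact: normr_ge0.
Qed.

Lemma integrable_gauss (f : R -> R) (K : R) : measurable_fun setT f ->
  (forall x, `|f x| <= K * (1 + x ^+ 2)) -> gauss.-integrable setT (EFin \o f).
Proof.
by move=> mf fK; apply: integrable_normal => //; apply: integrable_pdf_dominated fK.
Qed.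

(** These are the boundary terms of an integration by parts on [-n, n]; [e] stands for 1 or -1, so
    both ends are treated at once. *)
Let cvg_pdf0 (f : R -> R) (K : R) (e : R) : (forall x, `|f x| <= K * (1 + `|x|)) ->
  e ^+ 2 = 1 ->
  f (e * n%:R) * pdf (e * n%:R) @[n --> \oo] --> (0 : R).
Proof.
move=> fK e1; have K0 : 0 <= K.
  by have := fK 0; rewrite normr0 addr0 mulr1; apply: le_trans.
(* From (1 + n)^2 <= 2 (1 + n^2) and [pdf_dominated] the factor 8 would come out; 16 leaves slack
   for the arithmetic. *)
have bound n : `|f (e * n%:R) * pdf (e * n%:R)| <= (16 * K * normal_peak 1) * (n.+1%:R)^-1.
  rewrite normrM (ger0_norm (normal_pdf_ge0 _ _ _)).
  set y := e * n%:R.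
  have ny : `|y| = n%:R.
    have /eqP : `|e| = 1.
      by apply/eqP; rewrite -sqrp_eq1// -normrX e1 normr1.
    by rewrite normrM => /eqP ->; rewrite mul1r ger0_norm.
  have y2 : y ^+ 2 = n%:R ^+ 2 by rewrite -ny real_normK// num_real.
  have w1 : w y <= 1 by rewrite /w -expR0 ler_expR oppr_le0 divr_ge0// sqr_ge0.
  have pd := pdf_dominated y; have p0 := normal_peak_ge0 (1 : R).
  have {}pd : (1 + n%:R ^+ 2) * pdf y <= 4 * normal_peak 1.
    rewrite -y2; apply: le_trans pd _; rewrite ler_piMr// mulr_ge0//.
  have pg := normal_pdf_ge0 (0 : R) 1 y.
  have fy := fK y; rewrite ny in fy.
  rewrite ler_pdivlMr// -natr1.
  have n0 : (0 : R) <= n%:R by [].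
  apply: (@le_trans _ _ (K * (1 + n%:R) * pdf y * (n%:R + 1))).
    by rewrite ler_wpM2r ?addr_ge0// ler_wpM2r.
  have : 2 * K * ((1 + n%:R ^+ 2) * pdf y) <= 2 * K * (4 * normal_peak 1).
    by rewrite ler_wpM2l// mulr_ge0.
  have : 0 <= K * pdf y * (n%:R - 1) ^+ 2 by rewrite mulr_ge0 ?sqr_ge0// mulr_ge0.
  have : 0 <= K * normal_peak 1 by rewrite mulr_ge0.
  set N := n%:R; nra.
exact: cvgr0_le_harmonic bound.
Qed.

(** Integration by parts, as (f pdf)' = f' pdf - x f pdf. The linear growth of [f] kills the
    boundary terms, and the quadratic envelope makes the integrals over [-n, n] converge to the full
    one. *)
Lemma gauss_stein (f f' : R -> R) (K : R) :
  (forall x, is_derive x (1 : R) f (f' x)) -> continuous f' ->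
  (forall x, `|f x| <= K * (1 + `|x|)) -> (forall x, `|f' x| <= K) ->
  \int[gauss]_x f' x = \int[gauss]_x (x * f x).
Proof.
move=> df cf' fK f'K.
have cf : continuous f.
  by move=> x; apply: differentiable_continuous; apply/derivable1_diffP.
have mf : measurable_fun setT f by exact: continuous_measurable_fun.
have mf' : measurable_fun setT f' by exact: continuous_measurable_fun.
have K0 : 0 <= K by apply: le_trans (f'K 0).
have f'K2 x : `|f' x| <= 2 * K * (1 + x ^+ 2).
  by apply: le_trans (f'K x) _; have := mulr_ge0 K0 (sqr_ge0 x); lra.
have xfK2 x : `|x * f x| <= 2 * K * (1 + x ^+ 2).
  rewrite normrM; apply: le_trans (ler_wpM2l (normr_ge0 _) (fK x)) _.
  have -> : x ^+ 2 = `|x| ^+ 2 by rewrite real_normK// num_real.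
  have := mulr_ge0 K0 (sqr_ge0 (`|x| - 1)); have := mulr_ge0 K0 (sqr_ge0 (`|x|)).
  by set y := `|x|; nra.
have mxf : measurable_fun setT (fun x : R => x * f x) by exact: measurable_funM.
have if' := integrable_pdf_dominated mf' f'K2.
have ixf := integrable_pdf_dominated mxf xfK2.
pose h x := f' x * pdf x - x * f x * pdf x.
have mpdf : measurable_fun setT pdf by exact: measurable_normal_pdf.
have mh : measurable_fun setT h by apply: measurable_funB; exact: measurable_funM.
have ih : mu.-integrable setT (EFin \o h).
  have := integrableB measurableT if' ixf.
  by apply: eq_integrable => // x _; rewrite /= -EFinB.
suff h0 : \int[mu]_x h x = 0.
  apply/eqP; rewrite -subr_eq0; apply/eqP; rewrite -[RHS]h0.
  by rewrite {1 2}/Rintegral !integral_normal// -RintegralB.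
pose u n := \int[mu]_x (h x * \1_(`[- n%:R, n%:R] : set R) x).
have ucvg : u n @[n --> \oo] --> \int[mu]_x h x.
  apply: (dominated_cvg_Rintegral _ _ (integrable_norm ih) _).2.
  - by move=> n; apply: measurable_funM => //; exact: measurable_indic.
  - move=> x; apply: cvg_near_cst.
    near=> n; rewrite indicE mem_set ?mulr1//= in_itv/= -ler_norml.
    near: n; exact: nbhs_infty_ger.
  - move=> n x; rewrite normrM ler_piMr// indicE; case: (_ \in _) => /=; by rewrite ?normr1// normr0.
(* The index [n.+1] keeps the interval nondegenerate for the fundamental theorem of calculus. *)
have uE n : u n.+1 = f n.+1%:R * pdf n.+1%:R - f (- n.+1%:R) * pdf (- n.+1%:R).
  have ab : (- n.+1%:R : R) < n.+1%:R by rewrite gtrN.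
  rewrite /u (_ : (fun x => _) = h \_ `[- n.+1%:R, n.+1%:R]); last first.
    by rewrite patch_indic.
  rewrite -Rintegral_mkcond /Rintegral.
  have dF x : is_derive x (1 : R) (f \* pdf) (h x).
    have := df x; have := is_derive_pdf x => ? ?.
    apply: is_derive_eq; rewrite /GRing.scale/= /h; ring.
  have cF : continuous (f \* pdf).
    by move=> x; apply: differentiable_continuous; apply/derivable1_diffP.
  rewrite (@continuous_FTC2 _ h (f \* pdf))//.
  - apply: continuous_subspaceT => x; apply: cvgB; apply: cvgM.
    + exact: cf'.
    + by apply: continuous_normal_pdf; rewrite oner_eq0.
    + by apply: cvgM => //; exact: cf.
    + by apply: continuous_normal_pdf; rewrite oner_eq0.
  - split.
    + by move=> x _; exact: ex_derive.
    + exact/cvg_at_right_filter/cF.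
    + exact/cvg_at_left_filter/cF.
  - by move=> x _; rewrite derive1E derive_val.
suff u0 : u n.+1 @[n --> \oo] --> (0 : R).
  by move: u0; rewrite (cvg_shiftS u) => u0; exact: (cvg_unique _ ucvg u0).
rewrite (funext uE) -[X in _ --> X](subr0 0); apply: cvgB.
- have := cvg_pdf0 fK (expr1n R 2).
  rewrite -cvg_shiftS; apply: cvg_trans; apply: near_eq_cvg; apply: nearW => n.
  by rewrite /= mul1r.
- have := cvg_pdf0 fK (sqrr_sign R 1).
  rewrite -cvg_shiftS; apply: cvg_trans; apply: near_eq_cvg; apply: nearW => n.
  by rewrite /= expr1 mulN1r.
Unshelve. all: end_near. Qed.

Let integral_gauss_cst (r : R) : \int[gauss]_x r = r.
Proof.
rewrite Rintegral_cst; last exact: (@measurableT _ (measurableTypeR R)).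
by rewrite [X in fine X](@probability_setT _ _ _ gauss) mulr1.
Qed.

Lemma integral_gauss_sqr : \int[gauss]_x (x ^+ 2) = 1.
Proof.
rewrite -[RHS]integral_gauss_cst.
rewrite (_ : (fun x => x ^+ 2) = (fun x => x * id x)) //.
symmetry; apply: (@gauss_stein id (cst 1) 1).
- by move=> x; exact: cvg_cst.
- by move=> x; rewrite mul1r lerDr.
- by move=> x; rewrite normr1.
Qed.

Lemma integral_gauss_id : \int[gauss]_x x = 0.
Proof.
rewrite -[RHS]integral_gauss_cst.
rewrite (_ : id = (fun x => x * cst 1 x)); last by apply/funext => x; rewrite mulr1.
symmetry; apply: (@gauss_stein (cst 1) (cst 0) 1).
- by move=> x; exact: cvg_cst.
- by move=> x; rewrite normr1 mul1r lerDl.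
- by move=> x; rewrite normr0.
Qed.

Let continuous_affine (t b : R) : continuous (fun x : R => t + b * x).
Proof. by move=> x; apply: cvgD; [exact: cvg_cst|exact: mulrl_continuous]. Qed.

Lemma integrable_gauss_cos (t a : R) :
  gauss.-integrable setT (EFin \o (fun x => cos (t + a * x))).
Proof.
apply: (@integrable_bounded _ _ _ gauss (fun x => cos (t + a * x)) 1).
  apply: continuous_measurable_fun => x.
  by apply: continuous_comp; [exact: continuous_affine|exact: continuous_cos].
by move=> x; rewrite ler_norml cos_geN1 cos_le1.
Qed.

(* By [gauss_stein], phi a = E cos(t + a N) satisfies phi' = - a phi. *)
Lemma integral_gauss_cos (t a : R) :
  \int[gauss]_x cos (t + a * x) = cos t * expR (- (a ^+ 2 / 2)).
Proof.
have ccos (b : R) : continuous (fun x => cos (t + b * x)).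
  by move=> x; apply: continuous_comp; [exact: continuous_affine|exact: continuous_cos].
have msin (b : R) : measurable_fun setT (fun x : R => sin (t + b * x)).
  apply: continuous_measurable_fun => x.
  by apply: continuous_comp; [exact: continuous_affine|exact: continuous_sin].
pose phi (a : R) := \int[gauss]_x cos (t + a * x).
have dphi (b : R) : is_derive b (1 : R) phi (- b * phi b).
  have Ia : `](b - 1), (b + 1)[%classic b by rewrite /= in_itv/= ltrBlDr !ltrDl ltr01.
  have intf x : `](b - 1), (b + 1)[%classic x ->
      gauss.-integrable setT (EFin \o (fun y => cos (t + x * y))).
    by move=> _; exact: integrable_gauss_cos.
  have df (x y : R) :
      is_derive x (1 : R) (fun x => cos (t + x * y)) (- y * sin (t + x * y)).
    by apply: is_derive_eq; rewrite /GRing.scale/=; ring.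
  have derf1 (x y : R) : `](b - 1), (b + 1)[%classic x -> [set: R] y ->
    derivable ((fun x y => cos (t + x * y)) ^~ y) x (1 : R).
    by move=> _ _; exact: ex_derive.
  have d1 : partial1of2 (fun x y : R => cos (t + x * y)) =
      (fun x y : R => - y * sin (t + x * y)).
    by apply/funext => x; apply/funext => y; rewrite partial1of2E derive_val.
  have intG : gauss.-integrable setT (EFin \o (fun y : R => `|y|)).
    apply: (@integrable_gauss _ 1) => //.
    by move=> x; rewrite normr_id; have := sqr_ge0 (`|x| - 1); rewrite -(real_normK (num_real x)); set y := `|x|; nra.
  have G_ub (x y : R) : `](b - 1), (b + 1)[%classic x -> [set: R] y ->
      `|partial1of2 (fun x y : R => cos (t + x * y)) x y| <= `|y|.
    by move=> _ _; rewrite d1 normrM normrN ler_piMr// ler_norml sin_geN1 sin_le1.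
  have ex := derivable_under_integral measurableT Ia intf derf1 (fun y => normr_ge0 y) intG G_ub.
  have := differentiation_under_integral measurableT Ia intf derf1 (fun y => normr_ge0 y) intG G_ub.
  rewrite d1 derive1E => dv; apply: DeriveDef => //.
  rewrite /phi dv /= -RintegralZl//; last exact: integrable_gauss_cos.
  transitivity (\int[gauss]_y (-1 * (y * sin (t + b * y)))).
    by apply: eq_Rintegral => y _; ring.
  transitivity (\int[gauss]_y (-1 * (b * cos (t + b * y)))); last first.
    by apply: eq_Rintegral => y _; ring.
  have ibc : gauss.-integrable setT (EFin \o (fun y => b * cos (t + b * y))).
    have := integrableZl measurableT b (integrable_gauss_cos t b).
    by apply: eq_integrable.
  have iys : gauss.-integrable setT (EFin \o (fun y => y * sin (t + b * y))).
    apply: (@integrable_gauss _ 1) => [|x].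
      by apply: measurable_funM => //; exact: msin.
    rewrite mul1r normrM; apply: (@le_trans _ _ `|x|).
      by rewrite ler_piMr// ler_norml sin_geN1 sin_le1.
    by rewrite -(real_normK (num_real x)); have := sqr_ge0 (`|x| - 1);
      have := sqr_ge0 (`|x|); set y := `|x|; nra.
  rewrite RintegralZl// [RHS]RintegralZl//.
  congr (-1 * _).
  (* Stein's identity for the sine trades the factor y, produced by differentiating under the
     integral, for the factor b and turns the sine back into a cosine. *)
  symmetry; apply: (@gauss_stein (fun x => sin (t + b * x))
    (fun x => b * cos (t + b * x)) (1 + `|b|)).
  - move=> x; apply: is_derive_eq; rewrite /GRing.scale/=; ring.
  - move=> x; apply: cvgMr; exact: (ccos b).
  - move=> x; rewrite mulrDr mulr1 (le_trans _ (ler_wpDr _ (lexx _)))//.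
      by rewrite ler_wpDr// ler_norml sin_geN1 sin_le1.
  - move=> x; rewrite normrM; apply: (@le_trans _ _ `|b|).
      by rewrite ler_piMr// ler_norml cos_geN1 cos_le1.
    by rewrite lerDr.
have dg (b : R) : is_derive b (1 : R) (fun b => phi b * expR (b ^+ 2 / 2)) 0.
  have := dphi b => ?; apply: is_derive_eq; rewrite /GRing.scale/=.
  by field.
have := is_derive_0_is_cst a 0 dg.
rewrite expr0n /= mul0r expR0 mulr1 {2}/phi.
under eq_Rintegral do rewrite mul0r addr0.
rewrite integral_gauss_cst => h; rewrite expRN.
have e0 : expR (a ^+ 2 / 2) != 0 by rewrite gt_eqF// expR_gt0.
by apply: (mulIf e0); rewrite h mulfVK.
Qed.

End normal_integral.

(** * Fubini's theorem for finite measures and real-valued integrals *)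

Section fubini_bounded.
Context d1 d2 (T1 : measurableType d1) (T2 : measurableType d2) (R : realType).
Context (m1 : {finite_measure set T1 -> \bar R})
        (m2 : {finite_measure set T2 -> \bar R}).
Local Notation m1_ := (m1 : {sigma_finite_measure set T1 -> \bar R}).
Local Notation m2_ := (m2 : {sigma_finite_measure set T2 -> \bar R}).

Lemma integrable_prod_bounded (f : T1 * T2 -> R) (M : R) :
  measurable_fun setT f -> (forall z, `|f z| <= M) ->
  (m1_ \x m2_)%E.-integrable setT (EFin \o f).
Proof.
move=> mf fM; apply: measurable_bounded_integrable => //.
  rewrite -setXTT [ltLHS]product_measure1E// ltey_eq fin_numM//; exact: fin_num_measure.
by exists M; split; [exact: num_real|move=> x Mx y _; exact: le_trans (ltW Mx)].
Qed.

Lemma Rintegral21_prod (f : T1 * T2 -> R) :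
  (m1_ \x m2_)%E.-integrable setT (EFin \o f) ->
  (forall y, m1.-integrable setT (fun x => (f (x, y))%:E)) ->
  \int[m2]_y \int[m1]_x f (x, y) = \int[(m1_ \x m2_)%E]_z f z.
Proof.
move=> fi f1; rewrite /Rintegral -integral21_prod_meas1//; congr fine.
by apply: eq_integral => y _; rewrite fineK ?integrable_fin_num.
Qed.

Lemma Rintegral12_prod (f : T1 * T2 -> R) :
  (m1_ \x m2_)%E.-integrable setT (EFin \o f) ->
  (forall x, m2.-integrable setT (fun y => (f (x, y))%:E)) ->
  \int[m1]_x \int[m2]_y f (x, y) = \int[(m1_ \x m2_)%E]_z f z.
Proof.
move=> fi f2; rewrite /Rintegral -integral12_prod_meas1//; congr fine.
by apply: eq_integral => y _; rewrite fineK ?integrable_fin_num.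
Qed.

Lemma Fubini_bounded (f : T1 * T2 -> R) (M : R) :
  measurable_fun setT f -> (forall z, `|f z| <= M) ->
  \int[m1]_x \int[m2]_y f (x, y) = \int[m2]_y \int[m1]_x f (x, y).
Proof.
move=> mf fM; have fi := integrable_prod_bounded mf fM.
rewrite Rintegral12_prod// ?Rintegral21_prod// => [y|x].
- apply: (@integrable_bounded _ _ _ m1 (fun x => f (x, y)) M) => //.
  by apply: measurableT_comp => //; exact: measurable_pair2.
- apply: (@integrable_bounded _ _ _ m2 (fun y => f (x, y)) M) => //.
  by apply: measurableT_comp => //; exact: measurable_pair1.
Qed.

End fubini_bounded.

(** * Standard Gaussian vectors *)

Section gauss_vector.
Context {R : realType}.
Notation gauss := (normal_prob (0 : R) 1).

Section step.
Context (m : nat) (P : probability 'cV[R]_m R).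

Definition gauss_cons : set 'cV[R]_m.+1 -> \bar R :=
  pushforward (gauss \x P)%E (@cons_cV R m).

Let gauss_cons0 : gauss_cons set0 = 0%E.
Proof. by rewrite /gauss_cons /pushforward preimage_set0 measure0. Qed.

Let gauss_cons_ge0 A : (0 <= gauss_cons A)%E.
Proof. by rewrite /gauss_cons /pushforward measure_ge0. Qed.

Let gauss_cons_sigma_additive : semi_sigma_additive gauss_cons.
Proof.
move=> F mF tF mUF; rewrite /gauss_cons /pushforward preimage_bigcup.
apply: measure_semi_sigma_additive.
- by move=> n; rewrite -[X in measurable X]setTI; exact: measurable_cons_cV.
- by move=> i j _ _ [x [Fi Fj]]; apply: tF => //; exists (cons_cV x).
- rewrite -preimage_bigcup -[X in measurable X]setTI.
  exact: measurable_cons_cV.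
Qed.

HB.instance Definition _ := isMeasure.Build _ _ _ gauss_cons
  gauss_cons0 gauss_cons_ge0 gauss_cons_sigma_additive.

Let gauss_cons_setT : gauss_cons setT = 1%E.
Proof.
rewrite /gauss_cons /pushforward preimage_setT -setXTT product_measure1E//.
by rewrite -[RHS](mul1e 1%E); congr (_ * _)%E; exact: probability_setT.
Qed.

HB.instance Definition _ :=
  Measure_isProbability.Build _ _ _ gauss_cons gauss_cons_setT.

Lemma gauss_consE : gauss_cons = pushforward (gauss \x P)%E (@cons_cV R m).
Proof. by []. Qed.
End step.

(** The recursion on the dimension is that of [lebesgue_cV]; integrals unfold by induction into
    one-dimensional normal integrals. *)
Fixpoint gauss_cV m : probability 'cV[R]_m R :=
  match m with
  | 0 => dirac (0 : 'cV[R]_0)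
  | m'.+1 => gauss_cons (gauss_cV m')
  end.

Definition dotv m (u v : 'cV[R]_m) : R := \sum_i u i 0 * v i 0.

Lemma dotv_recl m (u : 'cV[R]_m.+1) :
  dotv u u = u ord0 0 ^+ 2 + dotv (\col_i u (lift ord0 i) 0) (\col_i u (lift ord0 i) 0).
Proof.
rewrite /dotv big_ord_recl expr2; congr (_ + _).
by apply: eq_bigr => i _; rewrite !mxE.
Qed.

Lemma dotv_cons m (u : 'cV[R]_m.+1) (x : R) (v : 'cV[R]_m) :
  dotv u (cons_cV (x, v)) = u ord0 0 * x + dotv (\col_i u (lift ord0 i) 0) v.
Proof.
rewrite /dotv big_ord_recl; congr (_ * _ + _).
  rewrite (_ : ord0 = lshift m (ord0 : 'I_1)); last exact/val_inj.
  by rewrite (col_mxEu (x%:M : 'M[R]_1)) mxE eqxx.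
apply: eq_bigr => i _; rewrite mxE; congr (_ * _).
rewrite (_ : lift ord0 i = rshift 1 i); last exact/val_inj.
by rewrite (col_mxEd (x%:M : 'M[R]_1)).
Qed.

Lemma measurable_dotv m (u : 'cV[R]_m) : measurable_fun setT (dotv u : _ -> R).
Proof.
apply: measurable_sum => i; apply: measurable_funM => //.
exact: measurable_coord.
Qed.

Lemma ge0_integral_gauss_cons m (f : 'cV[R]_m.+1 -> \bar R) :
  measurable_fun setT f -> (forall v, (0 <= f v)%E) ->
  (\int[gauss_cV m.+1]_v f v =
   \int[gauss_cV m]_v \int[gauss]_x f (cons_cV (x, v)))%E.
Proof.
move=> mf f0.
rewrite /= gauss_consE ge0_integral_pushforward//; last exact: measurable_cons_cV.
rewrite preimage_setT fubini_tonelli2//; last by move=> z; exact: f0.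
apply: measurableT_comp => //; exact: measurable_cons_cV.
Qed.

Lemma integral_gauss_cons m (f : 'cV[R]_m.+1 -> R) (M : R) :
  measurable_fun setT f -> (forall v, `|f v| <= M) ->
  \int[gauss_cV m.+1]_v f v =
  \int[gauss_cV m]_v \int[gauss]_x f (cons_cV (x, v)).
Proof.
move=> mf fM.
have mc := @measurable_cons_cV R m.
have mfc : measurable_fun setT (f \o @cons_cV R m) by exact: measurableT_comp.
have i2 := @integrable_prod_bounded _ _ _ _ _ gauss (gauss_cV m) _ M mfc (fun=> fM _).
rewrite (@Rintegral21_prod _ _ _ _ _ gauss (gauss_cV m) (f \o @cons_cV R m))//.
  by rewrite /Rintegral /= gauss_consE integral_pushforward//; exact/measurable_EFinP.
move=> v; apply: (@integrable_bounded _ _ _ gauss (fun x => f (cons_cV (x, v))) M) => //.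
apply: (measurableT_comp mfc); exact: measurable_pair2.
Qed.

Lemma measurable_cos_dotv m (t : R) (u : 'cV[R]_m) :
  measurable_fun setT (fun v : 'cV[R]_m => cos (t + dotv u v)).
Proof.
apply: measurableT_comp; first exact: continuous_measurable_fun (@continuous_cos R).
by apply: measurable_funD => //; exact: measurable_dotv.
Qed.

(** When the first coordinate is integrated out, the remaining ones enter only through the phase
    [t + dotv u' v]; this is why [integral_gauss_cos] carries a phase. *)
Lemma integral_gauss_cV_cos m (t : R) (u : 'cV[R]_m) :
  \int[gauss_cV m]_v cos (t + dotv u v) = cos t * expR (- (dotv u u / 2)).
Proof.
elim: m t u => [|m IH] t u.
  rewrite (_ : (fun v => cos _) = cst (cos t)); last first.
    by apply/funext => v; rewrite /dotv big_ord0 addr0.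
  rewrite Rintegral_cst// [X in fine X]probability_setT mulr1.
  by rewrite /dotv big_ord0 mul0r oppr0 expR0 mulr1.
rewrite (integral_gauss_cons (measurable_cos_dotv t u) (fun=> cos_max _)).
set u' := \col_i u (lift ord0 i) 0; set a := u ord0 0.
transitivity (\int[gauss_cV m]_v (expR (- (a ^+ 2 / 2)) * cos (t + dotv u' v))).
  apply: eq_Rintegral => v _.
  transitivity (\int[gauss]_x cos ((t + dotv u' v) + a * x)).
    by apply: eq_Rintegral => x _; rewrite dotv_cons; congr cos; rewrite addrAC -addrA.
  by rewrite integral_gauss_cos mulrC.
rewrite RintegralZl//; last first.
  exact: (@integrable_bounded _ _ _ (gauss_cV m) _ _ (measurable_cos_dotv t u') (fun=> cos_max _)).
rewrite IH mulrCA -expRD; congr (_ * expR _).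
by rewrite [dotv u u]dotv_recl -/a -/u' mulrDl opprD.
Qed.

Lemma integral_gauss_affine_sqr (a c : R) :
  (\int[gauss]_x ((a * x + c) ^+ 2)%:E = (a ^+ 2 + c ^+ 2)%:E)%E.
Proof.
have isq : gauss.-integrable setT (EFin \o (fun x : R => x ^+ 2)).
  apply: (@integrable_gauss _ _ 1) => // x.
  by rewrite mul1r ger0_norm ?sqr_ge0// lerDr.
have iid : gauss.-integrable setT (EFin \o (fun x : R => x)).
  apply: (@integrable_gauss _ _ 1) => // x; rewrite mul1r.
  by rewrite -(real_normK (num_real x)); have := sqr_ge0 (`|x| - 1); set y := `|x|; nra.
have icst : gauss.-integrable setT (EFin \o (fun x : R => c ^+ 2)).
  exact: (@integrable_bounded _ _ _ gauss (fun=> c ^+ 2) `|c ^+ 2|).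
have i1 : gauss.-integrable setT (EFin \o (fun x : R => a ^+ 2 * x ^+ 2)).
  by have := integrableZl measurableT (a ^+ 2) isq; apply: eq_integrable.
have i2 : gauss.-integrable setT (EFin \o (fun x : R => (2 * a * c) * x)).
  by have := integrableZl measurableT (2 * a * c) iid; apply: eq_integrable.
pose f1 (x : R) := a ^+ 2 * x ^+ 2; pose f2 (x : R) := 2 * a * c * x.
pose f3 (x : R) := c ^+ 2.
rewrite (_ : (fun x => _) =
    ((EFin \o f1) \+ ((EFin \o f2) \+ (EFin \o f3)))%E); last first.
  by apply/funext => x; rewrite /= -!EFinD; congr EFin; rewrite /f1 /f2 /f3; ring.
rewrite integralD//; last exact: integrableD.
rewrite integralD//.
have toR (f : R -> R) : gauss.-integrable setT (EFin \o f) ->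
    (\int[gauss]_x (EFin \o f) x)%E = (\int[gauss]_x f x)%:E.
  by move=> fi; rewrite /Rintegral fineK// integrable_fin_num.
rewrite !toR// RintegralZl// [X in (_ + (X%:E + _))%E]RintegralZl//.
rewrite integral_gauss_sqr integral_gauss_id Rintegral_cst//.
by rewrite mulr0 mulr1 [X in (_ * fine X)](@probability_setT _ _ _ gauss) mulr1 add0e.
Qed.

(** Stated in the extended reals, where nonnegativity alone justifies the iterated integrals. In the
    induction the cross term between the first and the other coordinates vanishes because a standard
    normal variable is centred. *)
Lemma integral_gauss_cV_sqr m (u : 'cV[R]_m) :
  (\int[gauss_cV m]_v (dotv u v ^+ 2)%:E = (dotv u u)%:E)%E.
Proof.
elim: m u => [|m IH] u.
  rewrite (_ : (fun v => _) = cst 0%E); last first.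
    by apply/funext => v; rewrite /dotv big_ord0 expr0n.
  by rewrite integral0 /dotv big_ord0.
rewrite ge0_integral_gauss_cons; last 2 first.
- by apply/measurable_EFinP; apply: measurable_funX; exact: measurable_dotv.
- by move=> v; rewrite lee_fin sqr_ge0.
set u' := \col_i u (lift ord0 i) 0; set a := u ord0 0.
transitivity (\int[gauss_cV m]_v ((a ^+ 2)%:E + (dotv u' v ^+ 2)%:E))%E.
  apply: eq_integral => v _.
  rewrite -EFinD -integral_gauss_affine_sqr; apply: eq_integral => x _.
  by rewrite dotv_cons.
rewrite ge0_integralD//; last 3 first.
- by move=> v _; rewrite lee_fin sqr_ge0.
- by move=> v _; rewrite lee_fin sqr_ge0.
- by apply/measurable_EFinP; apply: measurable_funX; exact: measurable_dotv.
rewrite integral_cst// [X in (_ * X)%E]probability_setT mule1 IH -EFinD.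
by rewrite [in RHS]dotv_recl.
Qed.

End gauss_vector.

(** * Taylor bounds for sine and cosine *)

Section sin_cos_bounds.
Context {R : realType}.
Implicit Type x : R.

Lemma norm_sin_le x : `|sin x| <= `|x|.
Proof.
wlog x0 : x / 0 <= x.
  move=> W; have [/W//|/ltW x0] := leP 0 x.
  by have := W (- x); rewrite sinN !normrN oppr_ge0; exact.
have [c _] := @MVT_segment R sin cos 0 x x0 (fun y _ => is_derive_sin y)
  (continuous_subspaceT (@continuous_sin R)).
by rewrite sin0 !subr0 => ->; rewrite normrM ler_piMl// cos_max.
Qed.

Lemma sin_sqr_le x : sin x ^+ 2 <= x ^+ 2.
Proof.
rewrite -(real_normK (num_real (sin x))) -(real_normK (num_real x)).
by rewrite ler_sqr ?nnegrE//; exact: norm_sin_le.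
Qed.

Lemma cosB1_half x : 1 - cos x = 2 * sin (x / 2) ^+ 2.
Proof.
have {1}-> : x = x / 2 + x / 2 by lra.
by rewrite cosD; have := cos2Dsin2 (x / 2); rewrite -!expr2; lra.
Qed.

Lemma norm_sin_sub_le x : `|sin x - x| <= `|x| ^+ 3.
Proof.
wlog x0 : x / 0 <= x.
  move=> W; have [/W//|/ltW x0] := leP 0 x.
  by have := W (- x); rewrite sinN -opprD !normrN oppr_ge0; exact.
have df (y : R) : is_derive y (1 : R) (fun z => sin z - z) (cos y - 1).
  by apply: is_derive_eq.
have cf : continuous (fun z : R => sin z - z).
  by move=> y; apply: cvgB; [exact: continuous_sin|exact: cvg_id].
have [c cx] := @MVT_segment R (fun z => sin z - z) (fun y => cos y - 1) 0 x x0
  (fun y _ => df y) (continuous_subspaceT cf).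
move: cx; rewrite in_itv /= => /andP[c0 cx].
rewrite sin0 !subr0 => ->; rewrite normrM exprSr ler_wpM2r//.
rewrite (ger0_norm x0) distrC cosB1_half ger0_norm; last by rewrite mulr_ge0// sqr_ge0.
have h := sin_sqr_le (c / 2).
apply: le_trans (ler_wpM2l _ h) _ => //.
by have := sqr_ge0 c; have : c ^+ 2 <= x ^+ 2 by [rewrite ler_sqr ?nnegrE]; lra.
Qed.

(** The cubic bound is better near 0 and gives pointwise limits; this quadratic one serves as a
    dominating function when only second moments exist. *)
Lemma norm_sin_sub_le_sqr x : `|sin x - x| <= 2 * x ^+ 2.
Proof.
rewrite -(real_normK (num_real x)).
have [x1|x1] := leP (`|x|) 1.
  apply: le_trans (norm_sin_sub_le x) _; rewrite exprSr.
  have := normr_ge0 x; have := sqr_ge0 (`|x|); set y := `|x| in x1 *; nra.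
apply: le_trans (ler_normB _ _) _; have := norm_sin_le x.
set y := `|x| in x1 *; set z := `|_|; nra.
Qed.

Lemma norm_cosB1_le x : `|1 - cos x| <= x ^+ 2.
Proof.
rewrite cosB1_half ger0_norm; last by rewrite mulr_ge0// sqr_ge0.
have := sin_sqr_le (x / 2).
by have := sqr_ge0 x; lra.
Qed.

Lemma norm_cos_taylor x : `|1 - cos x - x ^+ 2 / 2| <= x ^+ 4.
Proof.
rewrite cosB1_half; set u := x / 2.
have -> : x ^+ 2 / 2 = 2 * u ^+ 2 by rewrite /u; field.
have -> : x ^+ 4 = 16 * u ^+ 4 by rewrite /u; field.
rewrite -mulrBr subr_sqr !normrM ger0_norm//.
have h1 := norm_sin_sub_le u.
have h2 : `|sin u + u| <= 2 * `|u|.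
  by apply: le_trans (ler_normD _ _) _; have := norm_sin_le u; lra.
have -> : u ^+ 4 = `|u| ^+ 4 by rewrite -normrX ger0_norm// exprn_even_ge0.
have u0 := normr_ge0 u; have u4 : 0 <= `|u| ^+ 4 by rewrite exprn_ge0.
have : `|sin u - u| * `|sin u + u| <= `|u| ^+ 3 * (2 * `|u|) by apply: ler_pM.
have -> : `|u| ^+ 3 * (2 * `|u|) = 2 * `|u| ^+ 4 by ring.
lra.
Qed.

End sin_cos_bounds.

Lemma integrable_of_sqr d (T : measurableType d) (R : realType)
    (mu : {finite_measure set T -> \bar R}) (f : T -> R) :
  measurable_fun setT f ->
  mu.-integrable setT (EFin \o (fun x => f x ^+ 2)) ->
  mu.-integrable setT (EFin \o f).
Proof.
move=> mf f2.
have i1 := @integrable_bounded _ _ _ mu (cst 1) 1 (measurable_cst _) _.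
have := integrableD measurableT (i1 (fun=> ltac:(by rewrite normr1))) f2.
apply: le_integrable => //; first exact/measurable_EFinP.
move=> x _ /=; rewrite lee_fin; apply: le_trans (ler_norm _).
rewrite -(real_normK (num_real (f x))).
by have := sqr_ge0 (`|f x| - 1); set y := `|f x|; nra.
Qed.

Lemma norm_Rintegral_le d (T : measurableType d) (R : realType)
    (P : probability T R) (f : T -> R) (M : R) :
  measurable_fun setT f -> (forall x, `|f x| <= M) -> `|\int[P]_x f x| <= M.
Proof.
move=> mf fM; have fi := @integrable_bounded _ _ _ P f M mf fM.
apply: le_trans (le_normr_Rintegral measurableT fi) _.
have -> : M = \int[P]_x (cst M x).
  by rewrite Rintegral_cst// [X in fine X]probability_setT mulr1.
apply: le_Rintegral => //; first exact: integrable_norm.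
by apply: (@integrable_bounded _ _ _ P (cst M) `|M|).
Qed.

(** * Product formula for independent variables *)

Section independence.
Context d (T : measurableType d) (R : realType) (P : probability T R).

(** The joint law of (V1, V2) agrees with the product of the marginal laws on rectangles, hence
    everywhere by uniqueness of the product measure; Fubini's theorem on the product then splits the
    integral. *)
Lemma expectation_indep d1 d2 (S1 : measurableType d1) (S2 : measurableType d2)
    (V1 : T -> S1) (V2 : T -> S2) (f : S1 -> R) (g : S2 -> R) :
  measurable_fun setT V1 -> measurable_fun setT V2 ->
  (forall A B, measurable A -> measurable B ->
     P (V1 @^-1` A `&` V2 @^-1` B) = (P (V1 @^-1` A) * P (V2 @^-1` B))%E) ->
  measurable_fun setT f -> measurable_fun setT g ->
  P.-integrable setT (EFin \o (f \o V1)) ->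
  P.-integrable setT (EFin \o (g \o V2)) ->
  P.-integrable setT (EFin \o (fun w => f (V1 w) * g (V2 w))) /\
  \int[P]_w (f (V1 w) * g (V2 w)) =
  \int[P]_w f (V1 w) * \int[P]_w g (V2 w).
Proof.
move=> mV1 mV2 ind mf mg fi gi.
have m1 := isMeasurableFun.Build _ _ _ _ _ mV1.
have m2 := isMeasurableFun.Build _ _ _ _ _ mV2.
have mV12 := measurable_fun_pair mV1 mV2.
have m12 := isMeasurableFun.Build _ _ _ _ _ mV12.
pose X1 : {mfun T >-> S1} := HB.pack V1 m1.
pose X2 : {mfun T >-> S2} := HB.pack V2 m2.
pose X12 : {mfun T >-> (S1 * S2)%type} := HB.pack (fun w => (V1 w, V2 w)) m12.
pose Q1 := distribution P X1; pose Q2 := distribution P X2.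
pose Q12 := distribution P X12.
have QE A : measurable A -> (Q1 \x Q2)%E A = Q12 A.
  by apply: product_measure_unique => A' B mA mB; rewrite -ind.
pose h (z : S1 * S2) := f z.1 * g z.2.
have mh : measurable_fun setT h.
  by apply: measurable_funM; apply: measurableT_comp.
have fQ : Q1.-integrable setT (EFin \o f).
  by apply: integrable_pushforward => //; exact/measurable_EFinP.
have gQ : Q2.-integrable setT (EFin \o g).
  by apply: integrable_pushforward => //; exact/measurable_EFinP.
have hQ : (Q1 \x Q2)%E.-integrable setT (EFin \o h).
  apply/integrable12ltyP; first exact/measurable_EFinP.
  have [_ fooP] := integrableP _ _ _ fQ; have [_ gooP] := integrableP _ _ _ gQ.
  have G : (\int[Q2]_y `|(g y)%:E| \is a fin_num)%E by rewrite ge0_fin_numE// integral_ge0.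
  have F : (\int[Q1]_x `|(f x)%:E| \is a fin_num)%E by rewrite ge0_fin_numE// integral_ge0.
  have mabs d' (S' : measurableType d') (k : S' -> R) : measurable_fun setT k ->
      measurable_fun setT (fun x => `|(k x)%:E|%E).
    by move=> mk; apply: measurableT_comp => //; exact/measurable_EFinP.
  rewrite (_ : (\int[_]_x _)%E =
      (\int[Q1]_x (`|(f x)%:E| * \int[Q2]_y `|(g y)%:E|))%E).
    rewrite ge0_integralZr//; [|exact: mabs|exact: integral_ge0].
    by rewrite ltey_eq fin_numM.
  apply: eq_integral => x _ /=; rewrite -ge0_integralZl//; last exact: mabs.
  by apply: eq_integral => y _; rewrite /h/= normrM EFinM.
have mhE : measurable_fun setT (EFin \o h) by exact/measurable_EFinP.
have hQ12 : Q12.-integrable setT (EFin \o h).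
  apply/integrableP; split => //.
  have [_] := integrableP _ _ _ hQ; congr (_ < _)%E.
  by apply: eq_measure_integral => A mA _; exact: QE.
have hP : P.-integrable setT (EFin \o (h \o X12)).
  apply/integrableP; split.
    by apply/measurable_EFinP; exact: measurableT_comp.
  have [_] := integrableP _ _ _ hQ12; rewrite ge0_integral_distribution//.
  exact: measurableT_comp.
split; first exact: hP.
have -> : \int[P]_w (f (V1 w) * g (V2 w)) = \int[(Q1 \x Q2)%E]_z h z.
  rewrite /Rintegral (eq_measure_integral Q12); last by move=> A mA _; exact: QE.
  by rewrite integral_distribution.
have ig x : Q2.-integrable setT (fun y => (h (x, y))%:E).
  by have := integrableZl measurableT (f x) gQ; apply: eq_integrable.
rewrite -(@Rintegral12_prod _ _ _ _ _ Q1 Q2)//.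
transitivity (\int[Q1]_x (f x * \int[Q2]_y g y)).
  by apply: eq_Rintegral => x _; rewrite /h /= RintegralZl.
rewrite RintegralZr//; congr (_ * _).
  by rewrite /Rintegral integral_distribution//; exact/measurable_EFinP.
by rewrite /Rintegral integral_distribution//; exact/measurable_EFinP.
Qed.

End independence.

(** * Sums of i.i.d. terms and the scalar central limit theorem for cosines *)

Section iid.
Context d (T : measurableType d) (R : realType) (P : probability T R).
Context d' (S : measurableType d') (U : nat -> T -> S) (V : T -> S).
Hypothesis mU : forall i, measurable_fun setT (U i).
Hypothesis mV : measurable_fun setT V.
Hypothesis iid : iid_copies P U V.

Let ident (i : nat) (f : S -> R) : measurable_fun setT f ->
  P.-integrable setT (EFin \o (f \o V)) ->
  P.-integrable setT (EFin \o (f \o U i)) /\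
  \int[P]_w f (U i w) = \int[P]_w f (V w).
Proof.
move=> mf fi.
pose X : {mfun T >-> S} := HB.pack V (isMeasurableFun.Build _ _ _ _ _ mV).
pose Y : {mfun T >-> S} := HB.pack (U i) (isMeasurableFun.Build _ _ _ _ _ (mU i)).
have mfE : measurable_fun setT (EFin \o f) by exact/measurable_EFinP.
have E A : measurable A -> distribution P Y A = distribution P X A.
  by move=> mA; exact: iid.2.
have fX : (distribution P X).-integrable setT (EFin \o f).
  exact: integrable_pushforward.
have fYd : (distribution P Y).-integrable setT (EFin \o f).
  apply/integrableP; split => //; have [_] := integrableP _ _ _ fX.
  by congr (_ < _)%E; apply: eq_measure_integral => A mA _; exact/esym/E.
have fY : P.-integrable setT (EFin \o (f \o Y)).
  apply/integrableP; split.
    by apply/measurable_EFinP; exact: measurableT_comp.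
  have [_] := integrableP _ _ _ fYd; rewrite ge0_integral_distribution//.
  exact: measurableT_comp.
split; first exact: fY.
rewrite /Rintegral; congr fine.
rewrite -[LHS](@integral_distribution _ _ _ _ _ _ Y _ mfE fY).
rewrite -[RHS](@integral_distribution _ _ _ _ _ _ X _ mfE fi).
by apply: eq_measure_integral => A mA _; exact: E.
Qed.

(* Generates the sigma-algebra of U 0, ..., U (n - 1). *)
Let past (n : nat) : set (set T) :=
  [set A | exists2 B : nat -> set S, (forall i, measurable (B i)) &
     A = \bigcap_(i in [set` iota 0 n]) (U i @^-1` B i)].

Let past_sub n : past n `<=` measurable.
Proof.
move=> _ [B mB ->]; apply: fin_bigcap_measurable => [|i _].
  exact: finite_seq.
by rewrite -[X in measurable X]setTI; exact: mU.
Qed.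

(** For fixed [C] both sides are finite measures in [A]: the restriction of P to the event U n in C,
    and P scaled by the mass of that event. They agree on [past n], which is stable under
    intersection, hence on the sigma-algebra that it generates. *)
Let past_indep n A C : <<s past n >> A -> measurable C ->
  P (A `&` U n @^-1` C) = (P A * P (U n @^-1` C))%E.
Proof.
move=> pA mC.
have mD : measurable (U n @^-1` C) by rewrite -[X in measurable X]setTI; exact: mU.
have pn := fin_num_measure P _ mD.
have pge : 0 <= fine (P (U n @^-1` C)) by rewrite fine_ge0.
pose m2 := mscale (NngNum pge) P.
rewrite muleC.
have m2E X : m2 X = (P (U n @^-1` C) * P X)%E by rewrite /m2 /mscale /= fineK.
rewrite -m2E.
apply: (@g_sigma_algebra_measure_unique _ _ _ (past n) (@past_sub n) (fun=> setT)
  _ _ (mrestr P mD) m2) => //.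
- move=> _; exists (fun=> setT) => //.
  by rewrite bigcapT.
- by rewrite bigcup_const.
- move=> _ _ [B mB ->] [B' mB' ->]; exists (fun i => B i `&` B' i).
    by move=> i; exact: measurableI.
  by rewrite -bigcapI; apply: eq_bigcapr.
- move=> _ [B mB ->].
  apply: etrans; last exact/esym/m2E.
  change (P (\bigcap_(i in [set` iota 0 n]) U i @^-1` B i `&` U n @^-1` C) =
    (P (U n @^-1` C) * P (\bigcap_(i in [set` iota 0 n]) U i @^-1` B i))%E).
  (* The product rule is applied to the n + 1 indices [n :: iota 0 n], with [C] placed at index
     n. *)
  pose B' i := if i == n then C else B i.
  have uJ : uniq (n :: iota 0 n) by rewrite /= mem_iota /= ltnn iota_uniq.
  have mB' i : measurable (B' i) by rewrite /B'; case: ifP.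
  have BB' i : i \in iota 0 n -> B' i = B i.
    by rewrite mem_iota /= /B' => /ltn_eqF ->.
  have := iid.1 (n :: iota 0 n) B' uJ mB'.
  have -> : \bigcap_(i in [set` n :: iota 0 n]) U i @^-1` B' i =
      \bigcap_(i in [set` iota 0 n]) U i @^-1` B i `&` U n @^-1` C.
    apply/seteqP; split => w /= => [Bw|[Bw Cw] i /=].
      split=> [i /= ii|]; last by have := Bw n; rewrite /= /B' eqxx mem_head; exact.
      by have := Bw i; rewrite /= BB'// inE ii orbT; exact.
    by rewrite inE => /predU1P[->|ii]; [rewrite /B' eqxx|rewrite BB'//; exact: Bw].
  move=> ->; rewrite big_cons {1}/B' eqxx; congr (_ * _)%E; rewrite iid.1 ?iota_uniq//.
  by rewrite !big_seq; apply: eq_bigr => i /BB' ->.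
- move=> _; change (P (setT `&` U n @^-1` C) < +oo)%E.
  by rewrite setTI ltey_eq pn.
Qed.

Definition iid_sum (a : S -> R) (n : nat) (w : T) : R := \sum_(i < n) a (U i w).

(** The partial sum is measurable for the sigma-algebra generated by [past n], hence independent of
    [U n]. Independence enters everything below in this form only. *)
Lemma iid_step (a f : S -> R) (g : R -> R) (n : nat) :
  measurable_fun setT a -> measurable_fun setT f -> measurable_fun setT g ->
  P.-integrable setT (EFin \o (f \o V)) ->
  P.-integrable setT (EFin \o (g \o iid_sum a n)) ->
  P.-integrable setT (EFin \o (fun w => g (iid_sum a n w) * f (U n w))) /\
  \int[P]_w (g (iid_sum a n w) * f (U n w)) =
  \int[P]_w g (iid_sum a n w) * \int[P]_w f (V w).
Proof.
move=> ma mf mg fi gi.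
have [fUi <-] := ident n mf fi.
apply: expectation_indep => //.
- by apply: measurable_sum => i; exact: measurableT_comp.
- move=> A B mA mB; apply: past_indep => //.
  have mG : measurable_fun (setT : set (g_sigma_algebraType (past n)))
      (iid_sum a n : g_sigma_algebraType (past n) -> R).
    apply: measurable_sum => i; apply: measurableT_comp => //.
    move=> _ C mC; rewrite setTI; apply: sub_sigma_algebra.
    (* The event U i in C is a cylinder of [past n] whose other sides are the whole space. *)
    exists (fun j => if j == i :> nat then C else setT).
      by move=> j; case: ifP.
    apply/seteqP; split => [w Cw j _ /=|w /= Cw].
      by case: ifPn => // /eqP ->.
    by have := Cw (i : nat); rewrite /= mem_iota /= ltn_ord eqxx; exact.
  by have := mG measurableT _ mA; rewrite setTI.
Qed.

Lemma measurable_iid_sum (a : S -> R) n :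
  measurable_fun setT a -> measurable_fun setT (iid_sum a n).
Proof. by move=> ma; apply: measurable_sum => i; exact: measurableT_comp. Qed.

Lemma iid_sumS (a : S -> R) n w : iid_sum a n.+1 w = iid_sum a n w + a (U n w).
Proof. by rewrite /iid_sum big_ord_recr. Qed.

(** Variances add: the cross term in the square of the sum factors by [iid_step] and vanishes since
    [a] is centred. *)
Lemma iid_sum_moments (a : S -> R) n :
  measurable_fun setT a ->
  P.-integrable setT (EFin \o (fun w => a (V w) ^+ 2)) ->
  \int[P]_w a (V w) = 0 ->
  [/\ P.-integrable setT (EFin \o iid_sum a n),
      P.-integrable setT (EFin \o (fun w => iid_sum a n w ^+ 2)),
      \int[P]_w iid_sum a n w = 0 &
      \int[P]_w (iid_sum a n w ^+ 2) = n%:R * \int[P]_w (a (V w) ^+ 2)].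
Proof.
move=> ma a2 a0.
have ma2 : measurable_fun setT (fun s => a s ^+ 2) by exact: measurable_funX.
have ia : P.-integrable setT (EFin \o (a \o V)).
  apply: integrable_of_sqr => //; exact: measurableT_comp.
elim: n => [|n [i1 i2 e1 e2]].
  rewrite mul0r; split.
  - rewrite (_ : _ \o _ = cst 0%E); first exact: integrable0.
    by apply/funext => w; rewrite /= /iid_sum big_ord0.
  - rewrite (_ : _ \o _ = cst 0%E); first exact: integrable0.
    by apply/funext => w; rewrite /= /iid_sum big_ord0 expr0n.
  - rewrite (_ : iid_sum a 0 = cst 0) ?Rintegral_cst ?mul0r//.
    by apply/funext => w; rewrite /= /iid_sum big_ord0.
  - rewrite (_ : (fun w => _) = cst 0) ?Rintegral_cst ?mul0r//.
    by apply/funext => w; rewrite /= /iid_sum big_ord0 expr0n.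
have [iU eU] := ident n ma ia.
have [iU2 eU2] := ident n ma2 a2.
have [ix ex] := iid_step ma ma (@measurable_id _ _ setT) ia i1.
have ix2 : P.-integrable setT (EFin \o (fun w => 2 * (iid_sum a n w * a (U n w)))).
  by have := integrableZl measurableT 2 ix; apply: eq_integrable.
have E1 : iid_sum a n.+1 = (fun w => iid_sum a n w + a (U n w)).
  by apply/funext => w; rewrite iid_sumS.
have E2 : (fun w => iid_sum a n.+1 w ^+ 2) = (fun w => (iid_sum a n w ^+ 2
    + 2 * (iid_sum a n w * a (U n w))) + a (U n w) ^+ 2).
  by apply/funext => w; rewrite iid_sumS; ring.
have i12 : P.-integrable setT (EFin \o (fun w => iid_sum a n w ^+ 2
    + 2 * (iid_sum a n w * a (U n w)))).
  exact: (integrableD measurableT i2 ix2).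
split.
- rewrite E1; exact: (integrableD measurableT i1 iU).
- rewrite E2; exact: (integrableD measurableT i12 iU2).
- by rewrite E1 RintegralD// e1 eU a0 addr0.
- rewrite E2 RintegralD// RintegralD// RintegralZl// ex e1 mul0r mulr0 addr0.
  by rewrite e2 eU2 -natr1 mulrDl mul1r.
Qed.

(** A real-valued substitute for the multiplicativity of characteristic functions: the addition
    formula for the cosine, at the price of a sine term. *)
Lemma iid_cos_recursion (a : S -> R) n : measurable_fun setT a ->
  \int[P]_w cos (iid_sum a n.+1 w) =
  \int[P]_w cos (iid_sum a n w) * \int[P]_w cos (a (V w)) -
  \int[P]_w sin (iid_sum a n w) * \int[P]_w sin (a (V w)).
Proof.
move=> ma.
have mcos := continuous_measurable_fun (@continuous_cos R).
have msin := continuous_measurable_fun (@continuous_sin R).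
have mA := measurable_iid_sum n ma.
have mca : measurable_fun setT (fun s => cos (a s)) by exact: measurableT_comp.
have msa : measurable_fun setT (fun s => sin (a s)) by exact: measurableT_comp.
have ib (f : R -> R) (X : T -> R) : measurable_fun setT f -> (forall x : R, `|f x| <= 1) ->
    measurable_fun setT X -> P.-integrable setT (EFin \o (f \o X)).
  move=> mf f1 mX; apply: (@integrable_bounded _ _ _ P _ 1) => // [|w]; last exact: f1.
  exact: measurableT_comp.
have maV : measurable_fun setT (a \o V) by exact: measurableT_comp.
have [i1 <-] := iid_step ma mca mcos (ib _ _ mcos (@cos_max R) maV) (ib _ _ mcos (@cos_max R) mA).
have [i2 <-] := iid_step ma msa msin (ib _ _ msin (@sin_max R) maV) (ib _ _ msin (@sin_max R) mA).
rewrite -RintegralB//; apply: eq_Rintegral => w _.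
by rewrite iid_sumS cosD.
Qed.

(** Telescoping: each step of the recursion replaces one factor [q] by the mean cosine of one term.
    The mean sine of the partial sum is bounded only by 1, which is harmless because the mean sine
    of a single centred term, once rescaled, is o(1/n). *)
Lemma clt_cos_bound (a : S -> R) (q : R) n : measurable_fun setT a -> 0 <= q <= 1 ->
  `|\int[P]_w cos (iid_sum a n w) - q ^+ n| <=
  n%:R * (`|\int[P]_w cos (a (V w)) - q| + `|\int[P]_w sin (a (V w))|).
Proof.
move=> ma /andP[q0 q1]; elim: n => [|n IH].
  rewrite mul0r expr0 (_ : (fun w => _) = cst 1); last first.
    by apply/funext => w; rewrite /iid_sum big_ord0 cos0.
  by rewrite Rintegral_cst// [X in fine X]probability_setT mulr1 subrr normr0.
rewrite iid_cos_recursion// exprSr.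
set c := \int[P]_w cos _ in IH *; set s := \int[P]_w sin _.
set ca := \int[P]_w _ in IH *; set sa := \int[P]_w _ in IH *.
have bnd (f : R -> R) : measurable_fun setT f -> (forall x, `|f x| <= 1) ->
    `|\int[P]_w f (iid_sum a n w)| <= 1.
  move=> mf f1; apply: norm_Rintegral_le => [|w]; last exact: f1.
  by apply: measurableT_comp => //; exact: measurable_iid_sum.
have c1 : `|c| <= 1.
  by apply: bnd; [exact: continuous_measurable_fun (@continuous_cos R)|exact: cos_max].
have s1 : `|s| <= 1.
  by apply: bnd; [exact: continuous_measurable_fun (@continuous_sin R)|exact: sin_max].
have -> : c * ca - s * sa - q ^+ n * q = c * (ca - q) - s * sa + (c - q ^+ n) * q by ring.
apply: le_trans (ler_normD _ _) _; rewrite -natr1 [leRHS]mulrDl mul1r [leRHS]addrC lerD//; last first.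
  by rewrite normrM (ger0_norm q0) (le_trans _ IH)// ler_piMr.
apply: le_trans (ler_normB _ _) _; rewrite !normrM lerD// ler_piMl//.
Qed.

Let t (n : nat) : R := Num.sqrt (n%:R^-1).

Let t2 n : t n ^+ 2 = n%:R^-1.
Proof. by rewrite sqr_sqrtr// invr_ge0. Qed.

Let invn_cvg0 : (n%:R^-1 : R) @[n --> \oo] --> (0 : R).
Proof. by rewrite -cvg_shiftS; exact: cvg_harmonic. Qed.

Let t_cvg0 : t n @[n --> \oo] --> (0 : R).
Proof.
rewrite -(@sqrtr0 R); apply: continuous_cvg => //; exact: sqrt_continuous.
Qed.

Let cvg0_le (u v : nat -> R) : v n @[n --> \oo] --> (0 : R) ->
  (forall n, (0 < n)%N -> `|u n| <= v n) -> u n @[n --> \oo] --> (0 : R).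
Proof.
move=> v0 uv; apply: (@squeeze_cvgr _ _ _ _ (fun n => - v n) v) => //.
- by exists 1%N => // n n0; rewrite /= -ler_norml uv.
- by rewrite -[X in _ --> X]oppr0; exact: cvgN.
Qed.

Let cvg_of_sub (u : nat -> R) (l : R) : u n - l @[n --> \oo] --> (0 : R) ->
  u n @[n --> \oo] --> l.
Proof. by move/cvg_sub0; apply; exact: cvg_cst. Qed.

(** By [clt_cos_bound] it suffices that n (E cos - 1) and n (q n - 1) have the same limit -v/2 and
    that n E sin tends to 0, the cosine and sine being those of one term scaled by n^(-1/2). *)
Lemma clt_cos (a : S -> R) : measurable_fun setT a ->
  P.-integrable setT (EFin \o (fun w => a (V w) ^+ 2)) ->
  \int[P]_w a (V w) = 0 ->
  \int[P]_w cos (iid_sum (fun s => Num.sqrt (n%:R^-1) * a s) n w)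
    @[n --> \oo] --> expR (- (\int[P]_w (a (V w) ^+ 2) / 2)).
Proof.
move=> ma a2 a0; set v := \int[P]_w (a (V w) ^+ 2).
have v0 : 0 <= v by apply: Rintegral_ge0 => w _; exact: sqr_ge0.
have ia : P.-integrable setT (EFin \o (a \o V)).
  apply: integrable_of_sqr => //; exact: measurableT_comp.
have maV : measurable_fun setT (a \o V) by exact: measurableT_comp.
have mta n : measurable_fun setT (fun s => t n * a s) by exact: measurable_funM.
have mcos := continuous_measurable_fun (@continuous_cos R).
have msin := continuous_measurable_fun (@continuous_sin R).
have mc n : measurable_fun setT (fun w => cos (t n * a (V w))).
  by apply: measurableT_comp => //; exact: (measurableT_comp (mta n)).
have ms n : measurable_fun setT (fun w => sin (t n * a (V w))).
  by apply: measurableT_comp => //; exact: (measurableT_comp (mta n)).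
have ic n : P.-integrable setT (EFin \o (fun w => cos (t n * a (V w)))).
  by apply: (@integrable_bounded _ _ _ P _ 1) => // w; exact: cos_max.
have isn n : P.-integrable setT (EFin \o (fun w => sin (t n * a (V w)))).
  by apply: (@integrable_bounded _ _ _ P _ 1) => // w; exact: sin_max.
have i1 : P.-integrable setT (EFin \o (fun=> 1 : R)).
  by apply: (@integrable_bounded _ _ _ P _ 1) => // w; rewrite normr1.
(* Its n-th power equals the claimed limit expR (- (v / 2)) for every n > 0, so nothing is left to
   compare after [clt_cos_bound]. *)
pose q n := expR (- (v / 2 * n%:R^-1)).
have q01 n : 0 <= q n <= 1.
  by rewrite expR_ge0/= -expR0 ler_expR oppr_le0 !mulr_ge0// invr_ge0.
have cosl : n%:R * (\int[P]_w cos (t n * a (V w)) - 1) @[n --> \oo] --> - (v / 2).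
  have -> : - (v / 2) = \int[P]_w (- (a (V w) ^+ 2 / 2)).
    transitivity (\int[P]_w (- 2^-1 * (a (V w) ^+ 2))).
      by rewrite RintegralZl// -/v; ring.
    by apply: eq_Rintegral => w _; ring.
  rewrite (_ : (fun n => _) =
      (fun n => \int[P]_w (n%:R * (cos (t n * a (V w)) - 1)))); last first.
    apply/funext => n; rewrite RintegralZl//; last exact: (integrableB measurableT (ic n) i1).
    by rewrite RintegralB// Rintegral_cst// [X in fine X]probability_setT mulr1.
  (* The quartic Taylor remainder gives the pointwise limit, while the quadratic bound on 1 - cos
     gives domination by [a (V w) ^+ 2]. *)
  apply: (dominated_cvg_Rintegral _ _ a2 _).2.
  - by move=> n; apply: measurable_funM => //; exact: measurable_funB.
  - move=> w; apply: cvg_of_sub; apply: (@cvg0_le _ (fun n => a (V w) ^+ 4 * n%:R^-1)).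
      by rewrite -(mulr0 (a (V w) ^+ 4)); exact: cvgMr.
    move=> n n0; have n1 : n%:R != 0 :> R by rewrite pnatr_eq0 -lt0n.
    have := norm_cos_taylor (t n * a (V w)).
    rewrite -(ler_pM2l (_ : 0 < n%:R)) ?ltr0n// -[X in X * _ <= _](ger0_norm (ler0n _ n)) -normrM.
    rewrite exprMn t2; have -> : (t n * a (V w)) ^+ 4 = (t n ^+ 2) ^+ 2 * a (V w) ^+ 4 by ring.
    rewrite t2; set y := a (V w); rewrite [X in `|X|](_ : _ =
      - (n%:R * (cos (t n * y) - 1) - - (y ^+ 2 / 2))); last by field.
    by rewrite normrN => /le_trans; apply; rewrite le_eqVlt; apply/orP; left; apply/eqP; field.
  - move=> n w; have [->|n0] := posnP n; first by rewrite mul0r normr0 sqr_ge0.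
    have n1 : n%:R != 0 :> R by rewrite pnatr_eq0 -lt0n.
    rewrite normrM ger0_norm// distrC.
    apply: le_trans (ler_wpM2l _ (norm_cosB1_le _)) _ => //.
    by rewrite exprMn t2 mulrA divff// mul1r.
have ql : n%:R * (q n - 1) @[n --> \oo] --> - (v / 2).
  apply: cvg_of_sub; apply: (@cvg0_le _ (fun n => (v / 2) ^+ 2 * n%:R^-1)).
    by rewrite -(mulr0 ((v / 2) ^+ 2)); exact: cvgMr.
  move=> n n0; have n1 : n%:R != 0 :> R by rewrite pnatr_eq0 -lt0n.
  pose x := v / 2 * n%:R^-1; have x0 : 0 <= x by rewrite !mulr_ge0// invr_ge0.
  have : `|expR (- x) - 1 + x| <= x ^+ 2.
    have h1 := expR_ge1Dx (- x); rewrite ger0_norm; last by lra.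
    have : expR (- x) <= (1 + x)^-1.
      by rewrite expRN lef_pV2 ?posrE ?expR_gt0 ?expR_ge1Dx//; lra.
    have -> : (1 + x)^-1 = 1 - x + x ^+ 2 / (1 + x) by field; lra.
    have : x ^+ 2 / (1 + x) <= x ^+ 2.
      by rewrite ler_pdivrMr; [rewrite ler_peMr ?sqr_ge0//|]; lra.
    lra.
  rewrite -(ler_pM2l (_ : 0 < n%:R)) ?ltr0n// -[X in X * _ <= _](ger0_norm (ler0n _ n)) -normrM.
  rewrite [X in `|X|](_ : _ = n%:R * (q n - 1) - - (v / 2)); last by rewrite /q -/x /x; field.
  by move=> /le_trans; apply; rewrite le_eqVlt; apply/orP; left; apply/eqP; rewrite /x; field.
have sinl : n%:R * \int[P]_w sin (t n * a (V w)) @[n --> \oo] --> (0 : R).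
  have -> : (0 : R) = \int[P]_w (cst 0 w) by rewrite Rintegral_cst// mul0r.
  have ita n : P.-integrable setT (EFin \o (fun w => t n * a (V w))).
    by have := integrableZl measurableT (t n) ia; apply: eq_integrable.
  (* Since [a] is centred, the linear part of the sine can be subtracted under the integral without
     changing its value. *)
  rewrite (_ : (fun n => _) =
      (fun n => \int[P]_w (n%:R * (sin (t n * a (V w)) - t n * a (V w))))); last first.
    apply/funext => n; rewrite RintegralZl//; last exact: (integrableB measurableT (isn n) (ita n)).
    by rewrite RintegralB// (RintegralZl (t n))// a0 mulr0 subr0.
  have i2 : P.-integrable setT (EFin \o (fun w => 2 * a (V w) ^+ 2)).
    by have := integrableZl measurableT 2 a2; apply: eq_integrable.
  apply: (dominated_cvg_Rintegral _ _ i2 _).2.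
  - by move=> n; apply: measurable_funM => //; apply: measurable_funB => //; exact: (measurableT_comp (mta n)).
  - move=> w; apply: (@cvg0_le _ (fun n => `|a (V w)| ^+ 3 * t n)).
      by rewrite -(mulr0 (`|a (V w)| ^+ 3)); exact: cvgMr.
    move=> n n0; have n1 : n%:R != 0 :> R by rewrite pnatr_eq0 -lt0n.
    rewrite normrM ger0_norm//; apply: le_trans (ler_wpM2l _ (norm_sin_sub_le _)) _ => //.
    rewrite normrM (ger0_norm (sqrtr_ge0 _)) exprMn [t n ^+ 3]exprSr t2.
    set x := _ ^+ 3; rewrite (_ : _ * (_ * t n * x) = x * t n)//; by field.
  - move=> n w; have [->|n0] := posnP n; first by rewrite mul0r normr0 mulr_ge0// sqr_ge0.
    have n1 : n%:R != 0 :> R by rewrite pnatr_eq0 -lt0n.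
    rewrite normrM ger0_norm//.
    apply: le_trans (ler_wpM2l _ (norm_sin_sub_le_sqr _)) _ => //.
    by rewrite exprMn t2 mulrCA (mulrA n%:R) divff// mul1r.
apply: cvg_of_sub.
apply: (@cvg0_le _ (fun n => `|n%:R * (\int[P]_w cos (t n * a (V w)) - 1) - n%:R * (q n - 1)|
   + `|n%:R * \int[P]_w sin (t n * a (V w))|)).
  rewrite -(addr0 0); apply: cvgD.
    rewrite -(@normr0 _ R) -(subrr (- (v / 2))); apply: cvg_norm; exact: cvgB.
  by rewrite -(@normr0 _ R); exact: cvg_norm.
move=> n n0; have -> : expR (- (v / 2)) = q n ^+ n.
  rewrite /q -expRM_natl; congr expR; rewrite -mulr_natl; field.
  by rewrite pnatr_eq0 -lt0n.
apply: le_trans (clt_cos_bound n (mta n) (q01 n)) _.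
rewrite -mulrBr !(normrM n%:R) normr_nat -mulrDr; apply: ler_wpM2l => //.
by rewrite lerD2r (_ : _ - 1 - _ = \int[P]_w cos (t n * a (V w)) - q n)//; ring.
Qed.

End iid.

(** * Uniform continuity and the Weierstrass theorem *)

Section uniform_continuity.
Context {R : realType}.

(** Slightly more than uniform continuity on the segment: only [x] is confined to it and [y] may lie
    outside, as the Slutsky argument requires. Compactness is used in its near-covering form, half
    of the local radius being kept for moving the centre. *)
Lemma segment_unif_continuous (f : R -> R) (a b e : R) : continuous f -> 0 < e ->
  exists2 r : R, 0 < r &
    forall x y, x \in `[a, b] -> `|x - y| < r -> `|f x - f y| < e.
Proof.
move=> cf e0.
have := @segment_compact R a b; rewrite compact_near_coveringP.
move=> /(_ _ (0 : R)^'+ (fun (r x : R) => forall y, `|x - y| < r -> `|f x - f y| < e)).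
case.
- move=> x _; have /cvgrPdist_lt/(_ (e / 2)) := cf x.
  rewrite divr_gt0// => /(_ isT) [r /= r0 xr].
  exists ([set z | `|x - z| < r / 2], [set s | s < r / 2]) => /=.
    split; first by exists (r / 2) => //=; rewrite divr_gt0.
    by apply: nbhs_right_lt; rewrite divr_gt0.
  move=> [z s] /= [xz sr] y zy.
  have h1 : `|f x - f z| < e / 2 by apply: xr => /=; apply: lt_trans xz _; lra.
  have h2 : `|f x - f y| < e / 2.
    apply: xr => /=; rewrite (_ : x - y = (x - z) + (z - y)); last by ring.
    by apply: le_lt_trans (ler_normD _ _) _; lra.
  rewrite (_ : f z - f y = - (f x - f z) + (f x - f y)); last by ring.
  by apply: le_lt_trans (ler_normD _ _) _; rewrite normrN; lra.
- move=> r /= r0 H; exists (r / 2); first by rewrite divr_gt0.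
  move=> x y xab xy; apply: (H (r / 2)) => //=; last by rewrite divr_gt0.
  by rewrite sub0r normrN ger0_norm; lra.
Qed.

End uniform_continuity.

Section bernstein.
Context {R : realType}.
Implicit Types (f g : nat -> R) (x c : R) (n : nat).

(* The expectation of f(B) for B binomial with parameters n and x, by
   conditioning on the first trial; it is a polynomial in x. *)
Fixpoint bernstein n f : {poly R} :=
  if n is n'.+1 then 'X * bernstein n' (f \o succn) + (1 - 'X) * bernstein n' f
  else (f 0%N)%:P.

Lemma bernsteinS n f x : (bernstein n.+1 f).[x] =
  x * (bernstein n (f \o succn)).[x] + (1 - x) * (bernstein n f).[x].
Proof. by rewrite /= !hornerE. Qed.

Lemma le_bernstein n f g x : 0 <= x <= 1 -> (forall k, (k <= n)%N -> f k <= g k) ->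
  (bernstein n f).[x] <= (bernstein n g).[x].
Proof.
move=> /andP[x0 x1]; elim: n f g => [|n IH] f g fg.
  by rewrite /= !hornerC; exact: fg.
rewrite !bernsteinS lerD// ler_wpM2l ?subr_ge0//; apply: IH => k kn; apply: fg => //=.
exact: leqW.
Qed.

Lemma bernstein_lin n f g a b x :
  (bernstein n (fun k => a * f k + b * g k)).[x] =
  a * (bernstein n f).[x] + b * (bernstein n g).[x].
Proof.
elim: n f g => [|n IH] f g; first by rewrite /= !hornerC.
by rewrite !bernsteinS IH (IH (f \o succn) (g \o succn)); ring.
Qed.

Lemma bernstein_cst n a x : (bernstein n (fun=> a)).[x] = a.
Proof.
by elim: n => [|n IH]; rewrite ?bernsteinS /= ?hornerC// IH; ring.
Qed.

(** Squared bias plus the binomial variance n x (1 - x). The centre [c] is free because conditioning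
    on a first success shifts it to c - 1. *)
Lemma bernstein_sqr n c x :
  (bernstein n (fun k => (k%:R - c) ^+ 2)).[x] = (n%:R * x - c) ^+ 2 + n%:R * (x * (1 - x)).
Proof.
elim: n c => [|n IH] c; first by rewrite /= hornerC !mul0r !sub0r addr0.
rewrite bernsteinS IH.
have -> : (fun k => (k%:R - c) ^+ 2) \o succn = (fun k => (k%:R - (c - 1)) ^+ 2).
  by apply/funext => k /=; rewrite -natr1; congr (_ ^+ 2); ring.
by rewrite IH -natr1; ring.
Qed.

(** Bernstein's proof. The difference of f at x and k/n is below e/2 when |x - k/n| < r, and
    otherwise at most 2M, hence at most 2M (x - k/n)^2 / r^2. Both are below the quadratic function
    [g] of k, whose binomial mean is at most e/2 + 2M / (r^2 n). *)
Lemma weierstrass_unit (f : R -> R) (M e : R) : continuous f ->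
  (forall x, `|f x| <= M) -> 0 < e ->
  exists p : {poly R}, forall x, 0 <= x <= 1 -> `|f x - p.[x]| <= e.
Proof.
move=> cf fM e0; have e20 : 0 < e / 2 by rewrite divr_gt0.
have M0 : 0 <= M by apply: le_trans (fM 0).
have [r r0 fr] := segment_unif_continuous 0 1 cf e20.
have [n n0 nM] : exists2 n, (0 < n)%N & 2 * M / (r ^+ 2) / n%:R <= e / 2.
  exists (Num.truncn (4 * M / (r ^+ 2) / e)).+1 => //.
  rewrite ler_pdivrMr ?ltr0n//.
  have := truncnS_gt (4 * M / (r ^+ 2) / e); rewrite ltr_pdivrMr//.
  set N := _%:R; set A := M / r ^+ 2; have -> : 4 * M / r ^+ 2 = 4 * A by rewrite /A; ring.
  have -> : 2 * M / r ^+ 2 = 2 * A by rewrite /A; ring.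
  by lra.
have nR : (0 : R) < n%:R by rewrite ltr0n.
exists (bernstein n (fun k => f (k%:R / n%:R))) => x x01.
pose B : R := e / 2; pose A : R := 2 * M / r ^+ 2 / n%:R ^+ 2.
pose g k : R := B * 1 + A * (k%:R - n%:R * x) ^+ 2.
have A0 : 0 <= A by rewrite /A !mulr_ge0// ?invr_ge0 ?exprn_ge0// ltW.
have key k : `|f x - f (k%:R / n%:R)| <= g k.
  have sq : 0 <= A * (k%:R - n%:R * x) ^+ 2 by rewrite mulr_ge0// sqr_ge0.
  have [xk|xk] := ltP `|x - k%:R / n%:R| r.
    have : `|f x - f (k%:R / n%:R)| < e / 2 by apply: fr => //; rewrite in_itv.
    by rewrite /g /B; lra.
  apply: (@le_trans _ _ (2 * M)).
    by apply: le_trans (ler_normB _ _) _; have := fM x; have := fM (k%:R / n%:R); lra.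
  apply: (@le_trans _ _ (A * (k%:R - n%:R * x) ^+ 2)); last by rewrite /g /B; lra.
  have -> : A * (k%:R - n%:R * x) ^+ 2 = 2 * M * (`|x - k%:R / n%:R| ^+ 2 / r ^+ 2).
    by rewrite real_normK ?num_real// /A; field; rewrite !gt_eqF.
  by rewrite ler_peMr ?mulr_ge0// ler_pdivlMr ?exprn_gt0// mul1r ler_sqr ?nnegrE// ltW.
have gE : (bernstein n g).[x] <= e.
  rewrite bernstein_lin bernstein_cst bernstein_sqr subrr expr0n add0r mulr1.
  have -> : A * (n%:R * (x * (1 - x))) = 2 * M / r ^+ 2 / n%:R * (x * (1 - x)).
    by rewrite /A; field; rewrite !gt_eqF.
  have : 2 * M / r ^+ 2 / n%:R * (x * (1 - x)) <= 2 * M / r ^+ 2 / n%:R * 1.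
    rewrite ler_wpM2l ?mulr_ge0 ?invr_ge0 ?exprn_ge0// ?ltW//.
    by move: x01 => /andP[x0 x1]; nra.
  by rewrite /B; lra.
set F := bernstein n _.
(* Used with s = -1 and s = 1: monotonicity of [bernstein] gives one-sided comparisons, so the two
   signs of the absolute value are treated separately. *)
have E (s : R) : s * f x - s * F.[x] = (bernstein n (fun k => s * f x + (- s) * f (k%:R / n%:R))).[x].
  by rewrite (bernstein_lin _ (fun=> f x)) bernstein_cst; ring.
rewrite ler_norml; apply/andP; split.
  rewrite lerNl; apply: le_trans gE.
  rewrite (_ : - (f x - F.[x]) = (-1) * f x - (-1) * F.[x]); last by ring.
  rewrite E; apply: le_bernstein => // k _.
  by apply: le_trans (key k); apply: le_trans (ler_norm _) _; rewrite mulN1r opprK mul1r distrC addrC.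
apply: le_trans gE; rewrite (_ : f x - F.[x] = 1 * f x - 1 * F.[x]); last by ring.
rewrite E; apply: le_bernstein => // k _.
by apply: le_trans (key k); apply: le_trans (ler_norm _) _; rewrite mul1r mulN1r.
Qed.

End bernstein.

Section Rintegral_sum.
Context d (T : measurableType d) (R : realType) (mu : {measure set T -> \bar R}).

Lemma integrable_sum_EFin (J : Type) (s : seq J) (f : J -> T -> R) :
  (forall j, mu.-integrable setT (EFin \o f j)) ->
  mu.-integrable setT (EFin \o (fun x => \sum_(j <- s) f j x)).
Proof.
move=> fi; elim: s => [|j s IH].
  by rewrite (_ : _ \o _ = cst 0%E) ?integrable0//; apply/funext => x /=; rewrite big_nil.
have := integrableD measurableT (fi j) IH.
by apply: eq_integrable => // x _; rewrite /= big_cons.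
Qed.

Lemma Rintegral_sum (J : Type) (s : seq J) (f : J -> T -> R) :
  (forall j, mu.-integrable setT (EFin \o f j)) ->
  \int[mu]_x (\sum_(j <- s) f j x) = \sum_(j <- s) \int[mu]_x f j x.
Proof.
move=> fi; elim: s => [|j s IH].
  rewrite big_nil (_ : (fun x => _) = cst 0) ?Rintegral_cst ?mul0r//.
  by apply/funext => x; rewrite big_nil.
rewrite big_cons -IH -RintegralD//; last exact: integrable_sum_EFin.
by apply: eq_Rintegral => x _; rewrite big_cons.
Qed.

End Rintegral_sum.

(** * From Laplace transforms to convergence in law *)

Section laplace_continuity.
Context {R : realType}.

(** Integrals of polynomials in exp(-x) are thus combinations of Laplace transforms at natural
    numbers, which is why these are the only arguments considered below. *)
Lemma horner_expRN (p : {poly R}) (x : R) :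
  p.[expR (- x)] = \sum_(i < size p) p`_i * expR (- (i%:R * x)).
Proof.
rewrite horner_coef; apply: eq_bigr => i _.
by rewrite -expRM_natl -mulrN mulr_natl.
Qed.

Section one_measure.
Context d (T : measurableType d) (P : probability T R).
Variable W : T -> R.
Hypotheses (mW : measurable_fun setT W) (W0 : forall w, 0 <= W w).
Hypothesis iW : P.-integrable setT (EFin \o W).

Let integrable_expRN (i : nat) : P.-integrable setT (EFin \o (fun w => expR (- (i%:R * W w)))).
Proof.
apply: (@integrable_bounded _ _ _ P _ 1) => [|w].
  apply: measurableT_comp => //; apply: measurableT_comp => //.
  exact: measurable_funM.
by rewrite ger0_norm ?expR_ge0// -expR0 ler_expR oppr_le0 mulr_ge0.
Qed.

Lemma integrable_horner_expRN (p : {poly R}) :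
  P.-integrable setT (EFin \o (fun w => p.[expR (- W w)])).
Proof.
under eq_fun do rewrite horner_expRN.
apply: integrable_sum_EFin => i.
by have := integrableZl measurableT (p`_i) (integrable_expRN i); apply: eq_integrable.
Qed.

Lemma Rintegral_horner_expRN (p : {poly R}) :
  \int[P]_w p.[expR (- W w)] =
  \sum_(i < size p) p`_i * \int[P]_w expR (- (i%:R * W w)).
Proof.
under eq_Rintegral do rewrite horner_expRN.
rewrite Rintegral_sum => [|i].
  by apply: eq_bigr => i _; rewrite RintegralZl.
by have := integrableZl measurableT (p`_i) (integrable_expRN i); apply: eq_integrable.
Qed.

(** The approximation error is allowed to grow linearly, because the mean of the nonnegative
    variable [W] is at most [v]. *)
Lemma laplace_approx (g : R -> R) (p : {poly R}) (v A e : R) :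
  measurable_fun setT g -> (exists M, forall x, `|g x| <= M) ->
  0 <= A -> \int[P]_w W w <= v ->
  (forall x, 0 <= x -> `|g x - p.[expR (- x)]| <= A * x + e) ->
  `|\int[P]_w g (W w) - \int[P]_w p.[expR (- W w)]| <= A * v + e.
Proof.
move=> mg [M gM] A0 Wv gp.
have ig : P.-integrable setT (EFin \o (fun w => g (W w))).
  by apply: (@integrable_bounded _ _ _ P _ M) => [|w]; [exact: measurableT_comp|exact: gM].
have ip := integrable_horner_expRN p.
have iB := integrableB measurableT ig ip.
rewrite -RintegralB//; apply: le_trans (le_normr_Rintegral measurableT iB) _.
have iA : P.-integrable setT (EFin \o (fun w => A * W w)).
  by have := integrableZl measurableT A iW; apply: eq_integrable.
have ie : P.-integrable setT (EFin \o (fun=> e)).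
  by apply: (@integrable_bounded _ _ _ P _ `|e|).
apply: (@le_trans _ _ (\int[P]_w (A * W w + e))).
  apply: le_Rintegral => //; first exact: integrable_norm.
    exact: (integrableD measurableT iA ie).
  by move=> w _; exact: gp.
rewrite RintegralD// RintegralZl// Rintegral_cst// [X in fine X]probability_setT mulr1.
by rewrite lerD2r ler_wpM2l.
Qed.

End one_measure.

Lemma cvg_laplace d d' (T : measurableType d) (P : probability T R)
    (T' : measurableType d') (P' : probability T' R)
    (W : nat -> T -> R) (Q : T' -> R) (v : R) :
  (forall n, measurable_fun setT (W n)) -> (forall n w, 0 <= W n w) ->
  (forall n, P.-integrable setT (EFin \o W n)) ->
  (forall n, \int[P]_w W n w <= v) ->
  measurable_fun setT Q -> (forall w, 0 <= Q w) ->
  P'.-integrable setT (EFin \o Q) -> \int[P']_w Q w <= v ->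
  (forall i : nat, \int[P]_w expR (- (i%:R * W n w)) @[n --> \oo] -->
     \int[P']_w expR (- (i%:R * Q w))) ->
  forall g : R -> R, continuous g -> (exists M, forall x, `|g x| <= M) ->
  \int[P]_w g (W n w) @[n --> \oo] --> \int[P']_w g (Q w).
Proof.
move=> mW W0 iW Wv mQ Q0 iQ Qv lap g cg [M gM].
have mg : measurable_fun setT g by exact: continuous_measurable_fun.
have M0 : 0 <= M by apply: le_trans (gM 0).
have v0 : 0 <= v by apply: le_trans Qv; apply: Rintegral_ge0.
apply/cvgrPdist_le => e e0.
(* Chosen so that 2 M v / K <= e / 4, which bounds the tail contribution; the added 1 keeps K
   positive when M v = 0. *)
pose K := 1 + 8 * M * v / e.
have K0 : 0 < K by rewrite ltr_pwDl// divr_ge0 ?(ltW e0)// !mulr_ge0.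
(* g x = h (expR (- x)) for x in [0, K]; Markov's inequality controls W n > K. *)
pose h y := g (- ln (Num.max y (expR (- K)))).
have ch : continuous h.
  move=> y; apply: continuous_comp; last exact: cg.
  apply: cvgN; apply: continuous_comp.
    by apply: (@continuous_max _ _ id (cst (expR (- K)))); [exact: cvg_id|exact: cvg_cst].
  by apply: continuous_ln; rewrite lt_max expR_gt0 orbT.
have hM x : `|h x| <= M by exact: gM.
have e8 : 0 < e / 8 by rewrite divr_gt0.
have [p hp] := weierstrass_unit ch hM e8.
pose A := 2 * M / K.
have A0 : 0 <= A by rewrite /A !mulr_ge0// invr_ge0 ltW.
have Av : A * v <= e / 4.
  rewrite /A mulrAC ler_pdivrMr//.
  have -> : e / 4 * K = e / 4 + 2 * M * v by rewrite /K; field; rewrite gt_eqF.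
  by rewrite lerDr divr_ge0// ltW.
have gp x : 0 <= x -> `|g x - p.[expR (- x)]| <= A * x + e / 8.
  move=> x0; have y01 : 0 <= expR (- x) <= 1.
    by rewrite expR_ge0 -expR0 ler_expR oppr_le0.
  have := hp _ y01; rewrite /h; have [xK|Kx] := leP x K.
    rewrite max_l ?ler_expR ?lerN2// expRK opprK => /le_trans; apply.
    by rewrite lerDr mulr_ge0.
  (* Beyond K the polynomial still approximates [h], which is constantly g K there, so the error is
     at most 2 M + e / 8 and 2 M is absorbed in [A * x]. *)
  rewrite max_r ?ler_expR ?lerN2 ?(ltW Kx)// expRK opprK => h1.
  rewrite (_ : g x - _ = (g x - g K) + (g K - p.[expR (- x)])); last by ring.
  apply: le_trans (ler_normD _ _) _; apply: lerD => //.
  apply: (@le_trans _ _ (2 * M)).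
    by apply: le_trans (ler_normB _ _) _; have := gM x; have := gM K; lra.
  by rewrite /A mulrAC ler_pdivlMr// ler_wpM2l ?mulr_ge0// ltW.
have pcvg : \int[P]_w p.[expR (- W n w)] @[n --> \oo] --> \int[P']_w p.[expR (- Q w)].
  rewrite Rintegral_horner_expRN//.
  rewrite (_ : (fun n => _) =
      (fun n => \sum_(i < size p) p`_i * \int[P]_w expR (- (i%:R * W n w)))).
    by apply: cvg_big => [|i _]; [exact: add_continuous|apply: cvgMr; exact: lap].
  by apply/funext => n; rewrite Rintegral_horner_expRN.
have gb : exists M, forall x, `|g x| <= M by exists M.
(* Error budget: e/4 + e/8 for the limit, the same for W n, and e/8 for the convergence of the
   polynomial integrals. *)
have bQ := laplace_approx mQ Q0 iQ mg gb A0 Qv gp.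
move/cvgrPdist_le : pcvg => /(_ _ e8); apply: filterS => n pn.
have bW := laplace_approx (mW n) (W0 n) (iW n) mg gb A0 (Wv n) gp.
move: bQ bW pn; rewrite !ler_norml.
by move=> /andP[? ?] /andP[? ?] /andP[? ?]; apply/andP; split; lra.
Qed.

End laplace_continuity.

Section measurable_Rintegral.
Context d1 d2 (T1 : measurableType d1) (T2 : measurableType d2) (R : realType).
Context (m1 : {finite_measure set T1 -> \bar R}).

(** Measurability in the parameter is read off the integrable version of Fubini's theorem, for which
    some measure on [T2] must be supplied: here the Dirac mass at [y0]. *)
Lemma measurable_fun_Rintegral1 (f : T1 * T2 -> R) (M : R) (y0 : T2) :
  measurable_fun setT f -> (forall z, `|f z| <= M) ->
  measurable_fun setT (fun y => \int[m1]_x f (x, y)).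
Proof.
move=> mf fM.
have := @measurable_fubini_G _ _ T1 T2 R m1 (dirac y0) (EFin \o f)
  (@integrable_prod_bounded _ _ _ _ _ m1 (dirac y0) f M mf fM).
by move=> mG; apply: measurableT_comp => //; exact: measurable_fine.
Qed.

End measurable_Rintegral.

(** * The central limit theorem for the squared norm of a normalized sum *)

Section vector_clt.
Context d (T : measurableType d) (R : realType) (P : probability T R).
Context d' (S : measurableType d') (U : nat -> T -> S) (V : T -> S).
Hypothesis mU : forall i, measurable_fun setT (U i).
Hypothesis mV : measurable_fun setT V.
Hypothesis iid : iid_copies P U V.
Context (m : nat) (b : 'I_m -> S -> R).
Hypothesis mb : forall i, measurable_fun setT (b i).
Hypothesis ib2 : forall i, P.-integrable setT (EFin \o (fun w => b i (V w) ^+ 2)).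
Hypothesis ib0 : forall i, \int[P]_w b i (V w) = 0.

Let bv (w : T) : 'cV[R]_m := \col_i b i (V w).

Definition normalized_sum (n : nat) (w : T) : 'cV[R]_m :=
  \col_i (Num.sqrt n%:R^-1 * iid_sum U (b i) n w).

(** This is v^T Sigma v, with Sigma the covariance matrix of the centred vector b(V). For v standard
    Gaussian it has the law of |Sigma^(1/2) v|^2, the squared norm of the Gaussian limit, without
    forming a square root of Sigma. *)
Definition limit_form (v : 'cV[R]_m) : R := \int[P]_w (dotv v (bv w) ^+ 2).

Let mbV i : measurable_fun setT (fun w => b i (V w)).
Proof. exact: measurableT_comp. Qed.

Let ibb i j : P.-integrable setT (EFin \o (fun w => b i (V w) * b j (V w))).
Proof.
have := integrableD measurableT (ib2 i) (ib2 j).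
apply: le_integrable => //.
  by apply/measurable_EFinP; exact: measurable_funM.
move=> w _ /=; rewrite lee_fin; apply: le_trans (ler_norm _).
rewrite normrM -(real_normK (num_real (b i _))) -(real_normK (num_real (b j _))).
set x := `|_|; set y := `|_|.
by have := sqr_ge0 (x - y); have := sqr_ge0 (x + y); nra.
Qed.

Let dotvsqE v w : dotv v (bv w) ^+ 2 =
  \sum_i \sum_j (v i 0 * v j 0) * (b i (V w) * b j (V w)).
Proof.
rewrite expr2 /dotv big_distrl /=; apply: eq_bigr => i _.
rewrite big_distrr /=; apply: eq_bigr => j _; rewrite !mxE; ring.
Qed.

Let iterm (v : 'cV[R]_m) i j : P.-integrable setT
  (EFin \o (fun w => (v i 0 * v j 0) * (b i (V w) * b j (V w)) : R)) .
Proof.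
by have := integrableZl measurableT (v i 0 * v j 0) (ibb i j); apply: eq_integrable.
Qed.

Let integrable_dotv_sqr (v : 'cV[R]_m) :
  P.-integrable setT (EFin \o (fun w => dotv v (bv w) ^+ 2)).
Proof.
under eq_fun do rewrite dotvsqE.
by apply: integrable_sum_EFin => i; apply: integrable_sum_EFin => j.
Qed.

Lemma limit_formE v : limit_form v =
  \sum_i \sum_j (v i 0 * v j 0) * \int[P]_w (b i (V w) * b j (V w)).
Proof.
rewrite /limit_form; under eq_Rintegral do rewrite dotvsqE.
rewrite Rintegral_sum => [|i]; last exact: integrable_sum_EFin.
apply: eq_bigr => i _; rewrite Rintegral_sum//.
by apply: eq_bigr => j _; rewrite RintegralZl.
Qed.

Lemma limit_form_ge0 v : 0 <= limit_form v.
Proof. by apply: Rintegral_ge0 => w _; exact: sqr_ge0. Qed.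

Lemma measurable_limit_form : measurable_fun setT (limit_form : 'cV[R]_m -> R).
Proof.
rewrite (_ : limit_form = fun v =>
  \sum_i \sum_j (v i 0 * v j 0) * \int[P]_w (b i (V w) * b j (V w))); last first.
  by apply/funext => v; rewrite limit_formE.
apply: measurable_sum => i; apply: measurable_sum => j.
by apply: measurable_funM => //; apply: measurable_funM; exact: measurable_coord.
Qed.

Let measurable_dotv2 (d1 d2 : measure_display) (A : measurableType d1)
    (B : measurableType d2) (x : A -> 'cV[R]_m) (y : B -> 'cV[R]_m) :
  (forall i, measurable_fun setT (fun s => x s i 0 : R)) ->
  (forall i, measurable_fun setT (fun s => y s i 0 : R)) ->
  measurable_fun setT (fun z : A * B => dotv (x z.1) (y z.2)).
Proof.
move=> mx my; apply: measurable_sum => i; apply: measurable_funM.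
  exact: (measurableT_comp (mx i) measurable_fst).
exact: (measurableT_comp (my i) measurable_snd).
Qed.

Let mbv i : measurable_fun setT (fun w => bv w i 0).
Proof. by rewrite (_ : (fun w => _) = fun w => b i (V w))//; apply/funext => w; rewrite mxE. Qed.

Let dotvC (u v : 'cV[R]_m) : dotv u v = dotv v u.
Proof. by apply: eq_bigr => i _; rewrite mulrC. Qed.

(** By Tonelli the Gaussian variable is integrated first: for fixed w the second moment of <v, b(V
    w)> is |b(V w)|^2. The value is the trace of the covariance matrix. *)
Lemma integral_limit_form :
  (\int[gauss_cV m]_v (limit_form v)%:E = (\sum_i \int[P]_w (b i (V w) ^+ 2))%:E)%E.
Proof.
pose f (z : 'cV[R]_m * T) := ((dotv z.1 (bv z.2)) ^+ 2)%:E.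
have mf : measurable_fun setT f.
  apply/measurable_EFinP; apply: measurable_funX.
  by apply: (@measurable_dotv2 _ _ 'cV[R]_m T id bv) => // i; exact: measurable_coord.
transitivity (\int[gauss_cV m]_v \int[P]_w f (v, w))%E.
  by apply: eq_integral => v _; rewrite /limit_form /Rintegral fineK//;
    exact: (integrable_fin_num measurableT (integrable_dotv_sqr v)).
rewrite fubini_tonelli//; last by move=> z; rewrite lee_fin sqr_ge0.
transitivity (\int[P]_w (\sum_i b i (V w) ^+ 2)%:E)%E.
  apply: eq_integral => w _; rewrite /f /=.
  under eq_integral do rewrite dotvC.
  rewrite integral_gauss_cV_sqr; congr EFin.
  by apply: eq_bigr => i _; rewrite mxE expr2.
by rewrite -Rintegral_sum// /Rintegral fineK// integrable_fin_num//; exact: integrable_sum_EFin.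
Qed.

Let measurable_normalized_coord n i :
  measurable_fun setT (fun w => normalized_sum n w i 0).
Proof.
rewrite (_ : (fun t => _) = fun w => Num.sqrt n%:R^-1 * iid_sum U (b i) n w).
  by apply: measurable_funM => //; exact: measurable_iid_sum.
by apply/funext => w; rewrite mxE.
Qed.

Let dotv_normalizedE n w : dotv (normalized_sum n w) (normalized_sum n w) =
  \sum_i n%:R^-1 * iid_sum U (b i) n w ^+ 2.
Proof.
by apply: eq_bigr => i _; rewrite !mxE -expr2 exprMn sqr_sqrtr// invr_ge0.
Qed.

(** The mean equals that of the limit in [integral_limit_form], so one constant bounds all the means
    in [cvg_laplace]. The factor 1/n cancels the n of [iid_sum_moments] only for n > 0. *)
Lemma expectation_normalized_sum n : (0 < n)%N ->
  P.-integrable setT (EFin \o (fun w => dotv (normalized_sum n w) (normalized_sum n w))) /\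
  \int[P]_w dotv (normalized_sum n w) (normalized_sum n w) =
  \sum_i \int[P]_w (b i (V w) ^+ 2).
Proof.
move=> n0; have n1 : n%:R != 0 :> R by rewrite pnatr_eq0 -lt0n.
have mom i := iid_sum_moments mU mV iid n (mb i) (ib2 i) (ib0 i).
have isum i : P.-integrable setT (EFin \o (fun w => n%:R^-1 * iid_sum U (b i) n w ^+ 2)).
  have [_ i2 _ _] := mom i.
  by have := integrableZl measurableT n%:R^-1 i2; apply: eq_integrable.
split; first by under eq_fun do rewrite dotv_normalizedE; exact: integrable_sum_EFin.
under eq_Rintegral do rewrite dotv_normalizedE.
rewrite Rintegral_sum//; apply: eq_bigr => i _; have [_ i2 _ e2] := mom i.
by rewrite RintegralZl// e2 mulKf.
Qed.

(** After the exchange of integrals the Gaussian value v is fixed, and c <S_n, v> is a normalized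
    sum of scalar centred terms with variance c^2 limit_form v = 2 i limit_form v. [clt_cos] gives
    the limit for each v, and dominated convergence with bound 1 integrates it. *)
Lemma laplace_normalized_sum (i : nat) :
  \int[P]_w expR (- (i%:R * dotv (normalized_sum n w) (normalized_sum n w)))
    @[n --> \oo] --> \int[gauss_cV m]_v expR (- (i%:R * limit_form v)).
Proof.
pose c : R := Num.sqrt (2 * i%:R).
have c2 : c ^+ 2 = 2 * i%:R by rewrite sqr_sqrtr// mulr_ge0.
pose f n (z : T * 'cV[R]_m) := cos (0 + dotv (c *: normalized_sum n z.1) z.2).
have mf n : measurable_fun setT (f n).
  apply: measurableT_comp; first exact: continuous_measurable_fun (@continuous_cos R).
  apply: measurable_funD => //.
  apply: (@measurable_dotv2 _ _ T 'cV[R]_m (fun w => c *: normalized_sum n w) id) => j;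
    last exact: measurable_coord.
  rewrite (_ : (fun s => _) = fun s => c * normalized_sum n s j 0).
    exact: measurable_funM.
  by apply/funext => s; rewrite mxE.
have dotvZ (x y : 'cV[R]_m) : dotv (c *: x) y = c * dotv x y.
  by rewrite /dotv mulr_sumr; apply: eq_bigr => j _; rewrite mxE mulrA.
rewrite (_ : (fun n => _) = (fun n => \int[gauss_cV m]_v \int[P]_w f n (w, v))); last first.
  apply/funext => n; rewrite -(@Fubini_bounded _ _ _ _ _ P (gauss_cV m) (f n) 1 (mf n) (fun=> cos_max _)).
  apply: eq_Rintegral => w _; rewrite /f /= integral_gauss_cV_cos cos0 mul1r.
  by congr (expR (- _)); rewrite dotvZ dotvC dotvZ mulrA -expr2 c2; field.
have i1 : (gauss_cV m).-integrable setT (EFin \o (fun=> 1 : R)).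
  by apply: (@integrable_bounded _ _ _ (gauss_cV m) _ 1) => // v; rewrite normr1.
apply: (dominated_cvg_Rintegral _ _ i1 _).2.
- move=> n; apply: (@measurable_fun_Rintegral1 _ _ _ _ _ P (f n) 1 0 (mf n)) => z.
  exact: cos_max.
- move=> v; pose a s := c * dotv v (\col_j b j s).
  have ma : measurable_fun setT a.
    apply: measurable_funM => //; apply: measurable_sum => j; apply: measurable_funM => //.
    rewrite (_ : (fun s => _) = b j)//; by apply/funext => s; rewrite mxE.
  have aE w : a (V w) ^+ 2 = c ^+ 2 * dotv v (bv w) ^+ 2 by rewrite /a exprMn.
  have ia2 : P.-integrable setT (EFin \o (fun w => a (V w) ^+ 2)).
    under eq_fun do rewrite aE.
    by have := integrableZl measurableT (c ^+ 2) (integrable_dotv_sqr v); apply: eq_integrable.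
  have ib1 j : P.-integrable setT (EFin \o (fun w => b j (V w))) by exact: integrable_of_sqr.
  have ivb j : P.-integrable setT (EFin \o (fun w => v j 0 * b j (V w))).
    by have := integrableZl measurableT (v j 0) (ib1 j); apply: eq_integrable.
  have ia0 : \int[P]_w a (V w) = 0.
    transitivity (\int[P]_w (c * \sum_j v j 0 * b j (V w))).
      apply: eq_Rintegral => w _; congr (_ * _).
      by apply: eq_bigr => j _; rewrite mxE.
    rewrite RintegralZl//; last exact: integrable_sum_EFin.
    rewrite Rintegral_sum// big1 ?mulr0// => j _.
    by rewrite RintegralZl// ib0 mulr0.
  have := clt_cos mU mV iid ma ia2 ia0.
  rewrite (_ : \int[P]_w (a (V w) ^+ 2) / 2 = i%:R * limit_form v); last first.
    under eq_Rintegral do rewrite aE.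
    by rewrite RintegralZl// -/(limit_form v) c2; field.
  rewrite (_ : (fun n => \int[P]_w f n (w, v)) =
    (fun n => \int[P]_w cos (iid_sum U (fun s => Num.sqrt n%:R^-1 * a s) n w)))//.
  apply/funext => n; apply: eq_Rintegral => w _; rewrite /f add0r; congr cos.
  rewrite /a /iid_sum /= dotvZ dotvC /dotv.
  transitivity (c * \sum_j \sum_(k < n) v j 0 * (Num.sqrt n%:R^-1 * b j (U k w))).
    by congr (_ * _); apply: eq_bigr => j _; rewrite mxE /iid_sum !mulr_sumr.
  rewrite exchange_big mulr_sumr; apply: eq_bigr => k _; rewrite !mulr_sumr.
  by apply: eq_bigr => j _; rewrite mxE; ring.
- move=> n v; apply: norm_Rintegral_le => [|w]; last exact: cos_max.
  exact: (measurableT_comp (mf n) (@measurable_pair2 _ _ _ _ v)).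
Qed.

Lemma vector_clt (g : R -> R) : continuous g -> (exists M, forall x, `|g x| <= M) ->
  \int[P]_w g (dotv (normalized_sum n w) (normalized_sum n w)) @[n --> \oo] -->
  \int[gauss_cV m]_v g (limit_form v).
Proof.
move=> cg gM; rewrite -cvg_shiftS.
pose W n w := dotv (normalized_sum n.+1 w) (normalized_sum n.+1 w).
have dotv_ge0 (u : 'cV[R]_m) : 0 <= dotv u u.
  by apply: sumr_ge0 => i _; rewrite -expr2 sqr_ge0.
have fin : (\int[gauss_cV m]_v (limit_form v)%:E \is a fin_num)%E.
  by rewrite integral_limit_form.
apply: (@cvg_laplace R _ _ T P 'cV[R]_m (gauss_cV m) W limit_form
  (\sum_i \int[P]_w (b i (V w) ^+ 2))) => //.
- move=> n; apply: measurable_sum => i; exact: measurable_funM.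
- by move=> n w; exact: dotv_ge0.
- by move=> n; have [] := expectation_normalized_sum (ltn0Sn n).
- by move=> n; have [_ ->] := expectation_normalized_sum (ltn0Sn n).
- exact: measurable_limit_form.
- exact: limit_form_ge0.
- apply/integrableP; split; first by apply/measurable_EFinP; exact: measurable_limit_form.
  under eq_integral do rewrite /= ger0_norm ?limit_form_ge0//.
  by rewrite integral_limit_form ltry.
- by rewrite /Rintegral integral_limit_form.
- move=> i; rewrite /W (cvg_shiftS (fun n => \int[P]_w expR (- (i%:R *
    dotv (normalized_sum n w) (normalized_sum n w))))).
  exact: laplace_normalized_sum.
Qed.

End vector_clt.

(** * Perturbation of the inverse Gram matrix and of the projection trace *)

Section mxl1.
Context {R : realType}.

(** This norm is submultiplicative and invariant under transposition, and it is dual to the largest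
    entry, which is how [trace_mul_le] uses it. *)
Definition mxl1 m n (A : 'M[R]_(m, n)) : R := \sum_i \sum_j `|A i j|.

Lemma mxl1_ge0 m n (A : 'M[R]_(m, n)) : 0 <= mxl1 A.
Proof. by apply: sumr_ge0 => i _; apply: sumr_ge0. Qed.

Lemma mxl1_eq0 m n (A : 'M[R]_(m, n)) : mxl1 A = 0 -> A = 0.
Proof.
move/eqP; rewrite psumr_eq0 => [/allP A0|i _]; last exact: sumr_ge0.
apply/matrixP => i j; have := A0 i (mem_index_enum _).
rewrite psumr_eq0// => /allP/(_ j (mem_index_enum _)).
by rewrite normr_eq0 mxE => /eqP.
Qed.

Lemma mxl1D m n (A B : 'M[R]_(m, n)) : mxl1 (A + B) <= mxl1 A + mxl1 B.
Proof.
rewrite /mxl1 -big_split; apply: ler_sum => i _; rewrite -big_split.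
by apply: ler_sum => j _; rewrite mxE; exact: ler_normD.
Qed.

Lemma mxl1N m n (A : 'M[R]_(m, n)) : mxl1 (- A) = mxl1 A.
Proof. by apply: eq_bigr => i _; apply: eq_bigr => j _; rewrite mxE normrN. Qed.

Lemma mxl1_tr m n (A : 'M[R]_(m, n)) : mxl1 A^T = mxl1 A.
Proof.
by rewrite /mxl1 exchange_big; apply: eq_bigr => i _; apply: eq_bigr => j _; rewrite mxE.
Qed.

Lemma mxl1M m n p (A : 'M[R]_(m, n)) (B : 'M[R]_(n, p)) :
  mxl1 (A *m B) <= mxl1 A * mxl1 B.
Proof.
apply: (@le_trans _ _ (\sum_i \sum_k \sum_j `|A i j| * `|B j k|)).
  apply: ler_sum => i _; apply: ler_sum => k _; rewrite mxE.
  by apply: le_trans (ler_norm_sum _ _ _) _; apply: ler_sum => j _; rewrite normrM.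
rewrite /mxl1 mulr_suml; apply: ler_sum => i _; rewrite exchange_big mulr_suml.
apply: ler_sum => j _; rewrite -mulr_sumr ler_wpM2l// (bigD1 j)//= lerDl.
by apply: sumr_ge0 => k _; apply: sumr_ge0.
Qed.

(** No Neumann series is needed. With D = A - 1, a row v in the kernel satisfies |v| = |v D| <= |v|
    / 2, so it vanishes; and B = A^-1 - 1 satisfies B = - (B D + D), whence |B| <= |B| / 2 + |D|. *)
Lemma invmx_near1 n (A : 'M[R]_n) : mxl1 (A - 1%:M) <= 2^-1 ->
  A \in unitmx /\ mxl1 (invmx A - 1%:M) <= 2 * mxl1 (A - 1%:M).
Proof.
set D := A - 1%:M => D2; have AE : A = 1%:M + D by rewrite addrC subrK.
have uA : A \in unitmx.
  rewrite -row_free_unit -kermx_eq0; apply/rowV0P => v /sub_kermxP.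
  rewrite AE mulmxDr mulmx1 => /eqP; rewrite addr_eq0 => /eqP vE.
  apply: mxl1_eq0; apply/eqP; rewrite eq_le mxl1_ge0 andbT.
  have := mxl1M v D; rewrite -[mxl1 (v *m D)]mxl1N -vE.
  by have := mxl1_ge0 v; nra.
split=> //; set B := invmx A - 1%:M.
have BE : B = - (B *m D + D).
  apply/eqP; rewrite -addr_eq0; apply/eqP.
  rewrite addrA -{1}(mulmx1 B) -mulmxDr -AE /B mulmxBl mulVmx// mul1mx.
  by rewrite /D addrA subrK subrr.
have : mxl1 B <= mxl1 B * mxl1 D + mxl1 D.
  by rewrite {1}BE mxl1N; apply: le_trans (mxl1D _ _) _; rewrite lerD2r mxl1M.
have := mxl1_ge0 B; have := mxl1_ge0 D; nra.
Qed.

Lemma gram_near1 p k (E : 'M[R]_(p, k)) (e : R) : E^T *m E = 1%:M -> 0 < e ->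
  exists2 r : R, 0 < r & forall A : 'M[R]_(p, k),
    \sum_i \sum_j (A i j - E i j) ^+ 2 < r -> mxl1 (invmx (A^T *m A) - 1%:M) <= e.
Proof.
move=> E1 e0; pose L := mxl1 E; have L0 : 0 <= L := mxl1_ge0 E.
(* The bound 1/2 is the radius of [invmx_near1], and e/2 makes up for its factor 2. *)
pose t := Num.min 2^-1 (e / 2).
have t0 : 0 < t by rewrite lt_min divr_gt0// invr_gt0 ltr0n.
(* For F = A - E of norm at most s <= 1, the error E^T F + F^T E + F^T F has norm at most s (2 L +
   1) <= t. *)
pose s := Num.min 1 (t / (2 * L + 1)).
have s0 : 0 < s by rewrite lt_min ltr01 divr_gt0// ltr_wpDl// mulr_ge0.
(* At least the number of entries; the successor keeps it positive for an empty matrix. *)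
pose c : R := (p * k).+1%:R; have c0 : 0 < c by rewrite ltr0n.
exists ((s / c) ^+ 2); first by rewrite exprn_gt0// divr_gt0.
move=> A Ar; pose F := A - E.
have Fij i j : `|F i j| <= s / c.
  rewrite -(ler_sqr (x := `|_|)) ?nnegrE// ?divr_ge0 ?(ltW s0) ?(ltW c0)//.
  rewrite real_normK ?num_real//; apply: le_trans (ltW Ar).
  rewrite (bigD1 i)//= (bigD1 j)//= !mxE -addrA lerDl addr_ge0//.
    by apply: sumr_ge0 => ? _; exact: sqr_ge0.
  by apply: sumr_ge0 => ? _; apply: sumr_ge0 => ? _; exact: sqr_ge0.
have Fs : mxl1 F <= s.
  apply: (@le_trans _ _ (\sum_(i < p) \sum_(j < k) s / c)).
    by apply: ler_sum => i _; apply: ler_sum => j _.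
  rewrite !sumr_const !card_ord -mulrnA -mulr_natr mulrAC ler_pdivrMr//.
  by rewrite ler_wpM2l ?(ltW s0)// mulnC ler_nat leqnSn.
have D : mxl1 (A^T *m A - 1%:M) <= t.
  have -> : A^T *m A - 1%:M = E^T *m F + F^T *m E + F^T *m F.
    have -> : A = E + F by rewrite addrC subrK.
    have -> : (E + F)^T = E^T + F^T by apply/matrixP => i j; rewrite !mxE.
    by rewrite mulmxDl !mulmxDr E1 addrC -!addrA addKr.
  apply: le_trans (mxl1D _ _) _.
  have h1 : mxl1 (E^T *m F + F^T *m E) <= 2 * L * mxl1 F.
    apply: le_trans (mxl1D _ _) _.
    have := mxl1M E^T F; have := mxl1M F^T E; rewrite !mxl1_tr -/L; lra.
  have h2 : mxl1 (F^T *m F) <= mxl1 F * mxl1 F by have := mxl1M F^T F; rewrite mxl1_tr.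
  have F0 := mxl1_ge0 F.
  have s1 : s <= 1 by rewrite ge_min lexx.
  have st : s * (2 * L + 1) <= t.
    by rewrite -ler_pdivlMr ?ltr_wpDl ?mulr_ge0// ge_min lexx orbT.
  nra.
have t2 : t <= 2^-1 by rewrite ge_min lexx.
have te : t <= e / 2 by rewrite ge_min lexx orbT.
have [_] := invmx_near1 (le_trans D t2).
by move=> /le_trans; apply; lra.
Qed.

Lemma trace_mul_le k (N B : 'M[R]_k) (c : R) : (forall i j, `|N i j| <= c) ->
  `|\tr (N *m B)| <= c * mxl1 B.
Proof.
move=> Nc; apply: le_trans (ler_norm_sum _ _ _) _.
rewrite -mxl1_tr /mxl1 mulr_sumr; apply: ler_sum => i _; rewrite mxE mulr_sumr.
apply: le_trans (ler_norm_sum _ _ _) _; apply: ler_sum => j _.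
by rewrite normrM mxE ler_wpM2r.
Qed.

Definition frob2 m n (A : 'M[R]_(m, n)) : R := \sum_i \sum_j A i j ^+ 2.

Lemma frob2_ge0 m n (A : 'M[R]_(m, n)) : 0 <= frob2 A.
Proof. by apply: sumr_ge0 => i _; apply: sumr_ge0 => j _; exact: sqr_ge0. Qed.

Lemma frob2E m n (A : 'M[R]_(m, n)) : frob2 A = \tr (A^T *m A).
Proof.
rewrite /frob2 exchange_big; apply: eq_bigr => j _; rewrite mxE.
by apply: eq_bigr => i _; rewrite mxE expr2.
Qed.

Lemma gram_entry_le m n (A : 'M[R]_(m, n)) i j : `|(A^T *m A) i j| <= frob2 A.
Proof.
rewrite mxE; apply: le_trans (ler_norm_sum _ _ _) _; apply: ler_sum => l _.
rewrite mxE normrM.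
have h q : `|A l q| ^+ 2 <= \sum_q A l q ^+ 2.
  by rewrite real_normK ?num_real// (bigD1 q)//= lerDl sumr_ge0// => ? _; exact: sqr_ge0.
have := h i; have := h j; have := sqr_ge0 (`|A l i| - `|A l j|); nra.
Qed.

(** By cyclicity the trace is tr (N (A^T A)^-1) with N = (Q A)^T (Q A). Every entry of the Gram
    matrix N is at most its trace, which is the squared norm of Q A, so replacing the inverse by 1
    costs only a relative error. *)
Lemma trace_colproj_near p k (Q : 'M[R]_p) (E : 'M[R]_(p, k)) (e : R) :
  Q^T = Q -> Q *m Q = Q -> E^T *m E = 1%:M -> 0 < e ->
  exists2 r : R, 0 < r & forall A : 'M[R]_(p, k),
    \sum_i \sum_j (A i j - E i j) ^+ 2 < r ->
    `|\tr (Q *m colproj A) - frob2 (Q *m A)| <= e * frob2 (Q *m A).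
Proof.
move=> QT QQ E1 e0; have [r r0 Hr] := gram_near1 E1 e0.
exists r => // A /Hr Ae.
have -> : \tr (Q *m colproj A) = \tr ((Q *m A)^T *m (Q *m A) *m invmx (A^T *m A)).
  rewrite /colproj trmx_mul QT -!mulmxA (mulmxA Q Q) QQ.
  by rewrite [RHS]mxtrace_mulC !mulmxA.
rewrite frob2E -linearB /= -[X in _ - X]mulmx1 -mulmxBr.
apply: le_trans (trace_mul_le _ (gram_entry_le (Q *m A))) _.
by rewrite mulrC -frob2E ler_wpM2r// frob2_ge0.
Qed.

End mxl1.

(** * Measurability of matrix operations *)

Section measurable_matrix.
Context d (T : measurableType d) (R : realType).

Definition measurable_mx m n (F : T -> 'M[R]_(m, n)) :=
  forall i j, measurable_fun setT (fun w => F w i j : R).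

(* x^-1 is the limit of x / (x^2 + 1/n) also at 0, where both are 0. *)
Lemma measurable_invr : measurable_fun setT (@GRing.inv R : R -> R).
Proof.
have c n : continuous (fun x : R => x / (x ^+ 2 + n.+1%:R^-1)).
  move=> x; apply: cvgM; first exact: cvg_id.
  apply: cvgV; last by apply: cvgD; [exact: exprn_continuous|exact: cvg_cst].
  by rewrite gt_eqF// ltr_wpDl ?sqr_ge0// invr_gt0.
apply: (@measurable_fun_cvg _ _ _ setT (fun n (x : R) => x / (x ^+ 2 + n.+1%:R^-1)) (@GRing.inv R)).
  by move=> n; exact: continuous_measurable_fun (c n).
move=> x _; have [->|x0] := eqVneq x 0.
  rewrite invr0; apply: cvg_near_cst; apply: nearW => n; by rewrite mul0r.
have -> : x^-1 = x / (x ^+ 2 + 0) by rewrite addr0 expr2 invfM mulrA divff// mul1r.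
apply: cvgM; first exact: cvg_cst.
apply: cvgV; first by rewrite addr0 sqrf_eq0.
by apply: cvgD; [exact: cvg_cst|exact: cvg_harmonic].
Qed.

Lemma measurable_mulmx m n p (F : T -> 'M[R]_(m, n)) (G : T -> 'M[R]_(n, p)) :
  measurable_mx F -> measurable_mx G -> measurable_mx (fun w => F w *m G w).
Proof.
move=> mF mG i j; under eq_fun do rewrite mxE.
by apply: measurable_sum => k; exact: measurable_funM.
Qed.

Lemma measurable_trmx m n (F : T -> 'M[R]_(m, n)) :
  measurable_mx F -> measurable_mx (fun w => (F w)^T).
Proof. by move=> mF i j; under eq_fun do rewrite mxE; exact: mF. Qed.

Lemma measurable_det n (F : T -> 'M[R]_n) :
  measurable_mx F -> measurable_fun setT (fun w => \det (F w)).
Proof.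
move=> mF; apply: measurable_sum => s; apply: measurable_funM => //.
by apply: measurable_prod => i _; exact: mF.
Qed.

Lemma measurable_invmx n (F : T -> 'M[R]_n) :
  measurable_mx F -> measurable_mx (fun w => invmx (F w)).
Proof.
move=> mF i j; have md := measurable_det mF.
(* [invmx M] is [M] itself when M is singular. *)
have E w : invmx (F w) i j =
    (\det (F w))^-1 * cofactor (F w) j i + \1_[set 0] (\det (F w)) * F w i j.
  rewrite /invmx unitmxE unitfE indicE; have [d0|d0] := eqVneq (\det (F w)) 0.
    by rewrite d0 invr0 mul0r add0r mem_set//= mul1r.
  by rewrite !mxE memNset ?mul0r ?addr0//=; apply/eqP.
under eq_fun do rewrite E; apply: measurable_funD; apply: measurable_funM => //.
- exact: measurableT_comp measurable_invr md.
- apply: measurable_funM => //; apply: measurable_det => k l.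
  by under eq_fun do rewrite !mxE; exact: mF.
- by apply: measurableT_comp => //; exact: measurable_indic.
Qed.

Lemma measurable_mxtrace n (F : T -> 'M[R]_n) :
  measurable_mx F -> measurable_fun setT (fun w => \tr (F w)).
Proof. by move=> mF; apply: measurable_sum => i. Qed.

Lemma measurable_cst_mx m n (A : 'M[R]_(m, n)) : measurable_mx (fun=> A).
Proof. by move=> i j. Qed.

Lemma measurable_colproj m n (F : T -> 'M[R]_(m, n)) :
  measurable_mx F -> measurable_mx (fun w => colproj (F w)).
Proof.
move=> mF; have mFT := measurable_trmx mF.
exact: (measurable_mulmx (measurable_mulmx mF (measurable_invmx (measurable_mulmx mFT mF))) mFT).
Qed.

End measurable_matrix.

(** * A Slutsky lemma with relative error *)

Section slutsky.
Context d (T : measurableType d) (R : realType) (P : probability T R).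

(* X and X' are compared through a single error D: where D is small they are
   relatively close, and where D or X' is large the bound on g is used. *)
Lemma slutsky_relative (X X' D : nat -> T -> R) (v : R) (g : R -> R) :
  (forall n, measurable_fun setT (X n)) -> (forall n w, 0 <= X' n w) ->
  (forall n, P.-integrable setT (EFin \o X' n)) ->
  (forall n, \int[P]_w X' n w <= v) ->
  (forall n w, 0 <= D n w) ->
  (forall n, P.-integrable setT (EFin \o D n)) ->
  \int[P]_w D n w @[n --> \oo] --> (0 : R) ->
  (forall e, 0 < e -> exists2 r : R, 0 < r &
     forall n w, D n w < r -> `|X n w - X' n w| <= e * X' n w) ->
  continuous g -> (exists M, forall x, `|g x| <= M) ->
  \int[P]_w g (X n w) - \int[P]_w g (X' n w) @[n --> \oo] --> (0 : R).
Proof.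
move=> mX X'0 iX' X'v D0 iD Dcvg close cg [M gM].
have M0 : 0 <= M by apply: le_trans (gM 0).
have v0 : 0 <= v by apply: le_trans (X'v 0%N); apply: Rintegral_ge0.
have mg : measurable_fun setT g by exact: continuous_measurable_fun.
have mX' n : measurable_fun setT (X' n).
  by have /integrableP[/measurable_EFinP] := iX' n.
apply/cvgrPdist_le => e e0.
pose K := 1 + 8 * M * v / e.
have K0 : 0 < K by rewrite ltr_pwDl// divr_ge0 ?(ltW e0)// !mulr_ge0.
have e4 : 0 < e / 4 by rewrite divr_gt0.
have [s s0 gs] := segment_unif_continuous 0 K cg e4.
(* A relative error s / (2 K) on a value of at most K is an absolute error of at most s / 2, within
   the modulus of continuity [s]. *)
have sK : 0 < s / (2 * K) by rewrite divr_gt0// mulr_gt0.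
have [r r0 cr] := close _ sK.
pose A := 2 * M / K; pose B := 2 * M / r.
have A0 : 0 <= A by rewrite /A !mulr_ge0// invr_ge0 ltW.
have B0 : 0 <= B by rewrite /B !mulr_ge0// invr_ge0 ltW.
have Av : A * v <= e / 4.
  rewrite /A mulrAC ler_pdivrMr//.
  have -> : e / 4 * K = e / 4 + 2 * M * v by rewrite /K; field; rewrite gt_eqF.
  by rewrite lerDr ltW.
have gM2 x y : `|g x - g y| <= 2 * M.
  by apply: le_trans (ler_normB _ _) _; have := gM x; have := gM y; lra.
have key n w : `|g (X n w) - g (X' n w)| <= e / 4 + (A * X' n w + B * D n w).
  have a0 := mulr_ge0 A0 (X'0 n w); have b0 := mulr_ge0 B0 (D0 n w).
  have [Dr|rD] := ltP (D n w) r; last first.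
    apply: le_trans (gM2 _ _) _; have : 2 * M <= B * D n w.
      by rewrite /B mulrAC ler_pdivlMr// ler_wpM2l// mulr_ge0.
    by lra.
  have [X'K|KX'] := leP (X' n w) K; last first.
    apply: le_trans (gM2 _ _) _; have : 2 * M <= A * X' n w.
      by rewrite /A mulrAC ler_pdivlMr// ler_wpM2l ?mulr_ge0// ltW.
    by lra.
  have : `|g (X' n w) - g (X n w)| < e / 4.
    apply: gs; first by rewrite in_itv /= X'0.
    rewrite distrC; apply: le_lt_trans (cr n w Dr) _.
    apply: (@le_lt_trans _ _ (s / (2 * K) * K)); first by rewrite ler_wpM2l// ltW.
    have -> : s / (2 * K) * K = s / 2 by field; rewrite gt_eqF.
    by lra.
  by rewrite distrC; lra.
have igX (f : nat -> T -> R) n : measurable_fun setT (f n) ->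
    P.-integrable setT (EFin \o (fun w => g (f n w))).
  move=> mf; apply: (@integrable_bounded _ _ _ P _ M) => [|w]; last exact: gM.
  exact: measurableT_comp.
have e40 : P.-integrable setT (EFin \o (fun=> e / 4)).
  by apply: (@integrable_bounded _ _ _ P _ `|e / 4|).
have iAX n : P.-integrable setT (EFin \o (fun w => A * X' n w)).
  by have := integrableZl measurableT A (iX' n); apply: eq_integrable.
have iBD n : P.-integrable setT (EFin \o (fun w => B * D n w)).
  by have := integrableZl measurableT B (iD n); apply: eq_integrable.
have iABD n := integrableD measurableT (iAX n) (iBD n).
have bnd n : `|\int[P]_w g (X n w) - \int[P]_w g (X' n w)| <=
    e / 4 + (A * v + B * \int[P]_w D n w).
  have iB := integrableB measurableT (igX X n (mX n)) (igX X' n (mX' n)).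
  rewrite -RintegralB; [|exact: measurableT|exact: igX..].
  apply: le_trans (le_normr_Rintegral measurableT iB) _.
  apply: (@le_trans _ _ (\int[P]_w (e / 4 + (A * X' n w + B * D n w)))).
    apply: le_Rintegral => //; first exact: integrable_norm.
    exact: (integrableD measurableT e40 (iABD n)).
  rewrite RintegralD//; last exact: iABD.
  rewrite RintegralD// Rintegral_cst// [X in fine X]probability_setT mulr1.
  by rewrite (RintegralZl A)// (RintegralZl B)// !lerD// ler_wpM2l.
have : B * \int[P]_w D n w @[n --> \oo] --> (0 : R).
  by rewrite -[X in _ --> X](mulr0 B); exact: cvgMr.
move/cvgrPdist_le => /(_ _ e4); apply: filterS => n.
rewrite !sub0r !normrN => Bn; apply: le_trans (bnd n) _.
by have := ler_norm (B * \int[P]_w D n w); lra.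
Qed.

End slutsky.

(** * The finite-dimensional minimization problem *)

Section minimization.
Context {R : realType} (p d H : nat).
Variables (C : 'M[R]_(p, H)) (dv : 'rV[R]_H).
Variables (P1 : 'M[R]_(H, d)) (P2 : 'M[R]_(H, H - d)) (D0 : 'rV[R]_d).
Hypothesis dv_gt0 : forall h, 0 < dv 0 h.
Hypothesis P_orth : (row_mx P1 P2)^T *m row_mx P1 P2 = 1%:M /\
                    row_mx P1 P2 *m (row_mx P1 P2)^T = 1%:M.
Hypothesis D0_neq0 : forall k, D0 0 k != 0.
Hypothesis G_diag : (row_mx P1 P2)^T *m slice_G C dv *m row_mx P1 P2 =
  block_mx (diag_mx D0) 0 0 0.

Definition diag_sqrt n (v : 'rV[R]_n) : 'M[R]_n := diag_mx (map_mx Num.sqrt v).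

Lemma diag_sqrtK n (v : 'rV[R]_n) : (forall k, 0 < v 0 k) ->
  diag_sqrt v *m diag_invsqrt v = 1%:M.
Proof.
move=> v0; rewrite mulmx_diag -diag_const_mx; congr diag_mx.
by apply/rowP => k; rewrite !mxE divff// gt_eqF// sqrtr_gt0.
Qed.

Lemma frob2_eq0 m n (A : 'M[R]_(m, n)) : frob2 A = 0 -> A = 0.
Proof.
move/eqP; rewrite psumr_eq0 => [/allP A0|i _]; last first.
  by apply: sumr_ge0 => j _; exact: sqr_ge0.
apply/matrixP => i j; have := A0 i (mem_index_enum _).
rewrite psumr_eq0 => [/allP/(_ j (mem_index_enum _))|k _]; last exact: sqr_ge0.
by rewrite sqrf_eq0 mxE => /eqP.
Qed.

Local Notation slice_feasible a := ((C *m a)^T *m (C *m a) = 1%:M).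
Local Notation cost a := (frob2 (diag_sqrt dv *m a)).

Let P11 : P1^T *m P1 = 1%:M.
Proof.
have := P_orth.1; rewrite tr_row_mx mul_col_row scalar_mx_block.
by move=> /eq_block_mx[].
Qed.

Let P21 : P2^T *m P1 = 0.
Proof.
have := P_orth.1; rewrite tr_row_mx mul_col_row scalar_mx_block.
by move=> /eq_block_mx[].
Qed.

Let PP : P1 *m P1^T + P2 *m P2^T = 1%:M.
Proof. by have := P_orth.2; rewrite tr_row_mx mul_row_col. Qed.

Let slice_GE : slice_G C dv = P1 *m diag_mx D0 *m P1^T.
Proof.
have -> : slice_G C dv = row_mx P1 P2 *m
    ((row_mx P1 P2)^T *m slice_G C dv *m row_mx P1 P2) *m (row_mx P1 P2)^T.
  rewrite !mulmxA P_orth.2 mul1mx -mulmxA P_orth.2 mulmx1 //.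
by rewrite G_diag tr_row_mx mul_row_block mul_row_col !mulmx0 !addr0 mul0mx addr0.
Qed.

Let slice_G_gram : slice_G C dv = (C *m diag_invsqrt dv)^T *m (C *m diag_invsqrt dv).
Proof. by rewrite trmx_mul tr_diag_mx /slice_G !mulmxA. Qed.

(** [D0 0 k] is nonzero by assumption and is a diagonal entry of the Gram matrix of C D^(-1/2) P1,
    hence a sum of squares. *)
Let D0_gt0 k : 0 < D0 0 k.
Proof.
rewrite lt_neqAle eq_sym D0_neq0 /=.
have E : diag_mx D0 = P1^T *m slice_G C dv *m P1.
  by rewrite slice_GE !mulmxA P11 mul1mx -mulmxA P11 mulmx1.
have -> : D0 0 k = (diag_mx D0) k k by rewrite mxE eqxx.
rewrite E slice_G_gram -mulmxA -[_ *m _ *m P1]mulmxA mulmxA -trmx_mul mxE.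
by apply: sumr_ge0 => i _; rewrite mxE -expr2 sqr_ge0.
Qed.

Let gam (a : 'M[R]_(H, d)) : 'M[R]_d := diag_sqrt D0 *m P1^T *m (diag_sqrt dv *m a).

Let invK : diag_invsqrt dv *m diag_sqrt dv = 1%:M.
Proof. by apply: mulmx1C; exact: diag_sqrtK. Qed.

(** For b = D^(1/2) a one has (C a)^T (C a) = b^T G b with G = P1 D0 P1^T, and this is the Gram
    matrix of D0^(1/2) P1^T b. *)
Let feasibleE (a : 'M[R]_(H, d)) : slice_feasible a <-> (gam a)^T *m gam a = 1%:M.
Proof.
suff -> : (C *m a)^T *m (C *m a) = (gam a)^T *m gam a by [].
have -> : C *m a = C *m diag_invsqrt dv *m (diag_sqrt dv *m a).
  by rewrite -mulmxA (mulmxA (diag_invsqrt dv)) invK mul1mx.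
rewrite /gam; set A := C *m diag_invsqrt dv; set b := diag_sqrt dv *m a.
have -> : (A *m b)^T *m (A *m b) = b^T *m (A^T *m A) *m b.
  by rewrite (trmx_mul A b) !mulmxA.
rewrite -slice_G_gram slice_GE.
rewrite !(trmx_mul _ b) (trmx_mul _ P1^T) tr_diag_mx trmxK -!mulmxA; congr (_ *m (_ *m _)).
rewrite !mulmxA; congr (_ *m _ *m _); congr (_ *m _).
rewrite /diag_sqrt mulmx_diag; congr diag_mx; apply/rowP => k.
by rewrite !mxE -expr2 sqr_sqrtr// ltW.
Qed.

Let frob2_orth (v : 'rV[R]_d) (O : 'M[R]_d) : O *m O^T = 1%:M ->
  frob2 (diag_mx v *m O) = \sum_k v 0 k ^+ 2.
Proof.
move=> OO; rewrite frob2E mxtrace_mulC trmx_mul mulmxA -(mulmxA _ O) OO mulmx1.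
rewrite tr_diag_mx mulmx_diag mxtrace_diag.
by apply: eq_bigr => k _; rewrite mxE expr2.
Qed.

Let kappa : R := \sum_k ((Num.sqrt (D0 0 k))^-1) ^+ 2.

Let P1b a : P1^T *m (diag_sqrt dv *m a) = diag_invsqrt D0 *m gam a.
Proof.
rewrite /gam !mulmxA (mulmx1C (diag_sqrtK D0_gt0)) mul1mx //.
Qed.

Let frob2_split k (b : 'M[R]_(H, k)) :
  frob2 b = frob2 (P1^T *m b) + frob2 (P2^T *m b).
Proof.
rewrite !frob2E !trmx_mul !trmxK -linearD /=; congr mxtrace.
by rewrite -!mulmxA -mulmxDr (mulmxA P1) (mulmxA P2) -mulmxDl PP mul1mx.
Qed.

(** Pythagoras for the two blocks of the orthogonal matrix. The P1 part is D0^(-1/2) times [gam a],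
    which is square, so that its orthonormal columns make it orthogonal and the squared norm is that
    of D0^(-1/2). *)
Let costE (a : 'M[R]_(H, d)) : slice_feasible a ->
  cost a = kappa + frob2 (P2^T *m (diag_sqrt dv *m a)).
Proof.
move=> /feasibleE g1; have g2 := mulmx1C g1.
have -> : kappa = frob2 (P1^T *m (diag_sqrt dv *m a)).
  by rewrite P1b frob2_orth//; apply: eq_bigr => k _; rewrite mxE.
exact: frob2_split.
Qed.

Lemma slice_minimization (a : 'M[R]_(H, d)) :
  (slice_feasible a /\ forall b : 'M[R]_(H, d), slice_feasible b -> cost a <= cost b) <->
  exists O : 'M[R]_d, orthogonal_mx O /\
    a = diag_invsqrt dv *m P1 *m diag_invsqrt D0 *m O.
Proof.
pose sol (O : 'M[R]_d) := diag_invsqrt dv *m P1 *m diag_invsqrt D0 *m O.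
have bsol O : diag_sqrt dv *m sol O = P1 *m diag_invsqrt D0 *m O.
  by rewrite /sol !mulmxA diag_sqrtK// mul1mx.
have gsol O : gam (sol O) = O.
  rewrite /gam bsol !mulmxA -(mulmxA (diag_sqrt D0)) P11 mulmx1.
  by rewrite diag_sqrtK// mul1mx.
have fsol O : orthogonal_mx O -> slice_feasible (sol O).
  by move=> -[oO _]; apply/feasibleE; rewrite gsol.
have csol O : orthogonal_mx O -> cost (sol O) = kappa.
  move=> oO; rewrite costE; last exact: fsol.
  rewrite bsol !mulmxA P21 !mul0mx /frob2 [X in _ + X]big1 ?addr0// => i _.
  by rewrite big1// => j _; rewrite mxE expr0n.
split=> [[fa amin]|[M [oO ->]]]; last first.
  split; first exact: fsol.
  by move=> b fb; rewrite csol// (costE fb) lerDl frob2_ge0.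
have o1 : orthogonal_mx (1%:M : 'M[R]_d) by split; rewrite trmx1 mulmx1.
have := amin _ (fsol _ o1); rewrite (csol _ o1) (costE fa) gerDl => le0.
have f0 : frob2 (P2^T *m (diag_sqrt dv *m a)) = 0.
  by apply/eqP; rewrite eq_le le0 frob2_ge0.
have P2b : P2^T *m (diag_sqrt dv *m a) = 0.
  exact: frob2_eq0.
have /feasibleE g1 := fa.
(* The orthogonal factor is [gam a] itself: since P2^T b = 0, b = P1 P1^T b = P1 D0^(-1/2) (gam
   a). *)
exists (gam a); split; first by split => //; exact: mulmx1C.
transitivity (diag_invsqrt dv *m (diag_sqrt dv *m a)).
  by rewrite mulmxA invK mul1mx.
rewrite -[diag_sqrt dv *m a]mul1mx -PP mulmxDl -(mulmxA P2) P2b mulmx0 addr0.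
by rewrite -(mulmxA P1) P1b !mulmxA.
Qed.

End minimization.

(** * The mean is determined by bounded continuous test functions *)

Section law_mean.
Context {R : realType}.

(** The identity is unbounded, so its positive and negative parts are truncated at n and recovered
    by monotone convergence. No integrability is assumed: the two means agree as extended reals. *)
Lemma eq_law_mean (W1 W2 : probability (measurableTypeR R) R) :
  (forall f : R -> R, continuous f -> (exists M, forall x, `|f x| <= M) ->
     (\int[W1]_x (f x)%:E = \int[W2]_x (f x)%:E)%E) ->
  law_mean W1 = law_mean W2.
Proof.
move=> W12.
have E (h : R -> R) : continuous h -> (forall x, 0 <= h x) ->
    (\int[W1]_x (h x)%:E = \int[W2]_x (h x)%:E)%E.
  move=> ch h0.
  have trunc (W : probability (measurableTypeR R) R) :
      (\int[W]_x (Num.min (h x) n%:R)%:E @[n --> \oo] --> \int[W]_x (h x)%:E)%E.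
    have nd x : {homo (fun n => (Num.min (h x) n%:R)%:E) : n m / (n <= m)%N >-> (n <= m)%E}.
      by move=> n n' nn'; rewrite lee_fin le_min ge_min lexx /= ge_min ler_nat nn' orbT.
    have cv := @cvg_monotone_convergence _ _ _ W setT measurableT
      (fun n x => (Num.min (h x) n%:R)%:E).
    rewrite [X in _ --> X](_ : _ =
        (\int[W]_x limn (fun n => (Num.min (h x) n%:R)%:E))%E).
      apply: cv => [n|n x _|x _]; last exact: nd.
        apply/measurable_EFinP; apply: continuous_measurable_fun.
        by move=> x; apply: (@continuous_min _ _ h (cst n%:R)); [exact: ch|exact: cvg_cst].
      by rewrite lee_fin le_min h0 /=.
    apply: eq_integral => x _; apply/esym/cvg_lim => //; apply: cvg_near_cst.
    near=> n; congr EFin; apply/min_idPl.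
    by near: n; exact: nbhs_infty_ger.
  have e n : (\int[W1]_x (Num.min (h x) n%:R)%:E = \int[W2]_x (Num.min (h x) n%:R)%:E)%E.
    apply: W12.
      by move=> x; apply: (@continuous_min _ _ h (cst n%:R)); [exact: ch|exact: cvg_cst].
    exists n%:R => x; rewrite ger0_norm ?ge_min ?lexx ?orbT//.
    by rewrite le_min h0 /=.
  have := trunc W1; under eq_cvg do rewrite e; move=> h1.
  exact: (cvg_unique _ h1 (trunc W2)).
rewrite /law_mean integralE [RHS]integralE.
congr (_ - _)%E.
  rewrite (_ : _^\+%E = (fun x : R => (Num.max x 0)%:E)).
    apply: E => [x|x]; last by rewrite le_max lexx orbT.
    by apply: (@continuous_max _ _ id (cst 0)); [exact: cvg_id|exact: cvg_cst].
  by apply/funext => x; rewrite funeposE -EFin_max.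
rewrite (_ : _^\-%E = (fun x : R => (Num.max (- x) 0)%:E)).
  apply: E => [x|x]; last by rewrite le_max lexx orbT.
  by apply: (@continuous_max _ _ (fun x => - x) (cst 0)); [exact: cvgN|exact: cvg_cst].
by apply/funext => x; rewrite funenegE -EFinN -EFin_max.
Unshelve. all: end_near. Qed.

End law_mean.

(** * Square-integrable functions *)

Section square_integrable.
Context d (T : measurableType d) (R : realType) (mu : {measure set T -> \bar R}).

Lemma integrable_sqrD (f g : T -> R) :
  measurable_fun setT f -> measurable_fun setT g ->
  mu.-integrable setT (EFin \o (fun w => f w ^+ 2)) ->
  mu.-integrable setT (EFin \o (fun w => g w ^+ 2)) ->
  mu.-integrable setT (EFin \o (fun w => (f w + g w) ^+ 2)).
Proof.
move=> mf mg f2 g2.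
have := integrableZl measurableT 2 (integrableD measurableT f2 g2).
apply: le_integrable => //.
  by apply/measurable_EFinP; apply: measurable_funX; exact: measurable_funD.
move=> w _; rewrite /= lee_fin (ger0_norm (sqr_ge0 _)) ger0_norm; last first.
  by rewrite mulr_ge0// addr_ge0// sqr_ge0.
by have := sqr_ge0 (f w - g w); nra.
Qed.

Lemma integrable_sqrZ (c : R) (f : T -> R) :
  mu.-integrable setT (EFin \o (fun w => f w ^+ 2)) ->
  mu.-integrable setT (EFin \o (fun w => (c * f w) ^+ 2)).
Proof.
move=> f2; have := integrableZl measurableT (c ^+ 2) f2.
by apply: eq_integrable => // w _; rewrite /= exprMn.
Qed.

Lemma integrable_sqr_sum (J : Type) (s : seq J) (f : J -> T -> R) :
  (forall j, measurable_fun setT (f j)) ->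
  (forall j, mu.-integrable setT (EFin \o (fun w => f j w ^+ 2))) ->
  mu.-integrable setT (EFin \o (fun w => (\sum_(j <- s) f j w) ^+ 2)).
Proof.
move=> mf f2; elim: s => [|j s IH].
  rewrite (_ : _ \o _ = cst 0%E) ?integrable0//.
  by apply/funext => x /=; rewrite big_nil expr0n.
have := integrable_sqrD (mf j) (measurable_sum s mf) (f2 j) IH.
by apply: eq_integrable => // w _; rewrite /= big_cons.
Qed.

End square_integrable.

(** * The limit law of the trace statistic and its mean *)

Section trace_statistic_limit.
Context d (T : measurableType d) (R : realType) (P : probability T R).
Context (p k H : nat) (Y : T -> R) (Z : T -> 'cV[R]_p).
Context (Zs : nat -> T -> 'cV[R]_p) (Ys : nat -> T -> R).
Context (I : 'I_H -> set R) (Q : 'M[R]_p) (alpha : 'M[R]_(H, k)).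
Hypothesis mY : measurable_fun setT Y.
Hypothesis mZ : measurable_fun setT Z.
Hypothesis mYs : forall i, measurable_fun setT (Ys i).
Hypothesis mZs : forall i, measurable_fun setT (Zs i).
Hypothesis iid : iid_copies P (fun i w => (Zs i w, Ys i w)) (fun w => (Z w, Y w)).
Hypothesis mI : forall h, measurable (I h).
Hypothesis Z2 : forall i, P.-integrable setT (EFin \o (fun w => Z w i 0 ^+ 2)).
Hypothesis QT : Q^T = Q.
Hypothesis QQ : Q *m Q = Q.
Let eta := eta_mx P I Y Z alpha.
Hypothesis feas : eta^T *m eta = 1%:M.
Hypothesis Qeta : Q *m eta = 0.

Local Notation S := ('cV[R]_p * R)%type.
Let psi (j : 'I_k) (y : R) : R := slice_psi I alpha j y.
Let zeta (i : 'I_p) (j : 'I_k) (s : S) : R := s.1 i 0 * psi j s.2.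
(** An entry of Q Z psi(Y). It is centred because Q eta = 0, so the central limit theorem applies to
    Q eta_hat without recentring. *)
Let res (i : 'I_p) (j : 'I_k) (s : S) : R := (Q *m s.1) i 0 * psi j s.2.

Let mpsi j : measurable_fun setT (psi j : R -> R).
Proof.
apply: measurable_sum => h; apply: measurable_funM => //; exact: measurable_indic.
Qed.

Let mzeta i j : measurable_fun setT (zeta i j).
Proof.
apply: measurable_funM.
  exact: (measurableT_comp (measurable_coord i 0) measurable_fst).
exact: (measurableT_comp (mpsi j) measurable_snd).
Qed.

Let resE i j s : res i j s = \sum_l Q i l * zeta l j s.
Proof. by rewrite /res mxE mulr_suml; apply: eq_bigr => l _; rewrite mulrA. Qed.

Let mres i j : measurable_fun setT (res i j).
Proof.
rewrite (funext (resE i j)).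
by apply: measurable_sum => l; exact: measurable_funM.
Qed.

Let U n w : S := (Zs n w, Ys n w).
Let V w : S := (Z w, Y w).
Let mU n : measurable_fun setT (U n). Proof. exact: measurable_fun_pair. Qed.
Let mV : measurable_fun setT V. Proof. exact: measurable_fun_pair. Qed.

Let izeta2 i j : P.-integrable setT (EFin \o (fun w => zeta i j (V w) ^+ 2)).
Proof.
pose c : R := \sum_h `|alpha h j|.
have c0 : 0 <= c by exact: sumr_ge0.
have psic y : `|psi j y| <= c.
  apply: le_trans (ler_norm_sum _ _ _) _; apply: ler_sum => h _.
  by rewrite normrM ler_piMr// indicE; case: (_ \in _); rewrite ?normr1 ?normr0.
have := integrableZl measurableT (c ^+ 2) (Z2 i).
apply: le_integrable => //.
  by apply/measurable_EFinP; apply: measurable_funX; exact: measurableT_comp.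
move=> w _; rewrite /= lee_fin (ger0_norm (sqr_ge0 _)).
rewrite (ger0_norm (mulr_ge0 (sqr_ge0 c) (sqr_ge0 _))).
rewrite exprMn mulrC ler_wpM2r ?sqr_ge0// -(real_normK (num_real (psi _ _))).
by rewrite ler_sqr ?nnegrE.
Qed.

Let izeta i j : P.-integrable setT (EFin \o (fun w => zeta i j (V w))).
Proof. by apply: integrable_of_sqr => //; exact: measurableT_comp. Qed.

Let ezeta i j : \int[P]_w zeta i j (V w) = eta i j.
Proof. by rewrite /eta /eta_mx mxE unlock. Qed.

Let eres i j : \int[P]_w res i j (V w) = 0.
Proof.
under eq_Rintegral do rewrite resE.
have iQ l : P.-integrable setT (EFin \o (fun w => Q i l * zeta l j (V w))).
  by have := integrableZl measurableT (Q i l) (izeta l j); apply: eq_integrable.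
rewrite Rintegral_sum//.
transitivity ((Q *m eta) i j); last by rewrite Qeta mxE.
by rewrite mxE; apply: eq_bigr => l _; rewrite RintegralZl// ezeta.
Qed.

Let ires2 i j : P.-integrable setT (EFin \o (fun w => res i j (V w) ^+ 2)).
Proof.
under eq_fun do rewrite resE.
apply: integrable_sqr_sum => l.
  by apply: measurable_funM => //; exact: measurableT_comp.
exact: integrable_sqrZ.
Qed.

(** The residual is a p by k matrix while the central limit theorem concerns column vectors;
    enumerating the pairs of indices flattens it. *)
Let m := #|{: 'I_p * 'I_k}|.
Let b (q : 'I_m) : S -> R := res (enum_val q).1 (enum_val q).2.

Let sum_ij (F : 'I_p -> 'I_k -> R) :
  \sum_(q < m) F (enum_val q).1 (enum_val q).2 = \sum_i \sum_j F i j.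
Proof.
rewrite pair_bigA /= (reindex (enum_val : 'I_m -> 'I_p * 'I_k)) //=.
by apply: onW_bij; exact: enum_val_bij.
Qed.

Let etahat n w := eta_hat_mx I Ys Zs alpha n w.

Let etahatE n w i j : etahat n w i j = n%:R^-1 * iid_sum U (zeta i j) n w.
Proof. by rewrite mxE. Qed.

(** The squared Frobenius norm of Q eta_hat carries n^-2 and the normalized sum n^(-1/2), which
    accounts for the factor n. For n = 0 both sides are 0. *)
Let Qetahat n w : n%:R * frob2 (Q *m etahat n w) =
  dotv (normalized_sum U b n w) (normalized_sum U b n w).
Proof.
have [->|n0] := posnP n.
  rewrite mul0r /dotv big1// => q _.
  by rewrite !mxE /iid_sum big_ord0 mulr0 mul0r.
have n1 : n%:R != 0 :> R by rewrite pnatr_eq0 -lt0n.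
transitivity (\sum_i \sum_j n%:R^-1 * iid_sum U (res i j) n w ^+ 2).
  rewrite /frob2 mulr_sumr; apply: eq_bigr => i _; rewrite mulr_sumr.
  apply: eq_bigr => j _; rewrite mxE.
  have -> : \sum_l Q i l * etahat n w l j = n%:R^-1 * iid_sum U (res i j) n w.
    rewrite /iid_sum; under [in RHS]eq_bigr do rewrite resE.
    rewrite exchange_big /= mulr_sumr; apply: eq_bigr => l _.
    by rewrite etahatE /iid_sum !mulr_sumr; apply: eq_bigr => i' _; ring.
  by field.
rewrite -(sum_ij (fun i j => n%:R^-1 * iid_sum U (res i j) n w ^+ 2)).
apply: eq_bigr => q _; rewrite !mxE -expr2 exprMn sqr_sqrtr ?invr_ge0//.
Qed.

Let mean_cost : R := \sum_i \sum_j \int[P]_w (res i j (V w) ^+ 2).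

Let err n w := \sum_i \sum_j (etahat n w i j - eta i j) ^+ 2.

(** The law of large numbers in mean square: the centred sums have second moment n times a variance,
    so the mean of the squared error is of order 1/n. *)
Let err_cvg : (forall n, P.-integrable setT (EFin \o err n.+1)) /\
  \int[P]_w err n.+1 w @[n --> \oo] --> (0 : R).
Proof.
pose c i j (s : S) := zeta i j s - eta i j.
have mc i j : measurable_fun setT (c i j) by exact: measurable_funB.
have mcV i j : measurable_fun setT (fun w => c i j (V w)) by exact: measurableT_comp.
have icst (r : R) : P.-integrable setT (EFin \o (fun=> r)).
  by apply: (@integrable_bounded _ _ _ P _ `|r|).
have ic2 i j : P.-integrable setT (EFin \o (fun w => c i j (V w) ^+ 2)).
  apply: integrable_sqrD => //; first exact: measurableT_comp.
have ec i j : \int[P]_w c i j (V w) = 0.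
  rewrite RintegralB//.
  by rewrite Rintegral_cst// [X in fine X]probability_setT mulr1 ezeta subrr.
have errE n w : err n.+1 w = \sum_i \sum_j (n.+1%:R ^- 2) * iid_sum U (c i j) n.+1 w ^+ 2.
  apply: eq_bigr => i _; apply: eq_bigr => j _; rewrite etahatE.
  have -> : iid_sum U (c i j) n.+1 w = iid_sum U (zeta i j) n.+1 w - n.+1%:R * eta i j.
    by rewrite /iid_sum sumrB sumr_const card_ord mulr_natl.
  have : n.+1%:R != 0 :> R by rewrite pnatr_eq0.
  by move: (n.+1%:R : R) => N N0; field.
have mom n i j := iid_sum_moments mU mV iid n (mc i j) (ic2 i j) (ec i j).
have it n i j : P.-integrable setT (EFin \o (fun w => n.+1%:R ^- 2 * iid_sum U (c i j) n.+1 w ^+ 2)).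
  have [_ i2 _ _] := mom n.+1 i j.
  by have := integrableZl measurableT (n.+1%:R ^- 2) i2; apply: eq_integrable.
split=> [n|].
  rewrite (funext (errE n)).
  by apply: integrable_sum_EFin => i; exact: integrable_sum_EFin.
apply: (@cvgr0_le_harmonic _ _ (\sum_i \sum_j \int[P]_w (c i j (V w) ^+ 2))) => n.
rewrite (funext (errE n)) Rintegral_sum => [|i]; last exact: integrable_sum_EFin.
rewrite mulr_suml ger0_norm.
  apply: ler_sum => i _; rewrite Rintegral_sum// mulr_suml; apply: ler_sum => j _.
  have [_ i2 _ e2] := mom n.+1 i j; rewrite RintegralZl// e2.
  have : n.+1%:R != 0 :> R by rewrite pnatr_eq0.
  move: (n.+1%:R : R) => N N0; rewrite le_eqVlt; apply/orP; left; apply/eqP.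
  by field.
apply: sumr_ge0 => i _; rewrite Rintegral_sum//; apply: sumr_ge0 => j _.
by apply: Rintegral_ge0 => w _; rewrite mulr_ge0 ?sqr_ge0// invr_ge0 exprn_ge0.
Qed.

Lemma trace_stat_cvg_in_law : exists W : probability (measurableTypeR R) R,
  cvg_in_law P (trace_stat I Ys Zs Q alpha) W /\
  law_mean W = (\sum_i \sum_j \int[P]_w (res i j (V w) ^+ 2))%:E.
Proof.
have mb q : measurable_fun setT (b q) by exact: mres.
have ib2 q : P.-integrable setT (EFin \o (fun w => b q (V w) ^+ 2)) by exact: ires2.
have ib0 q : \int[P]_w b q (V w) = 0 by exact: eres.
have costE : \sum_q \int[P]_w (b q (V w) ^+ 2) = mean_cost.
  exact: (sum_ij (fun i j => \int[P]_w (res i j (V w) ^+ 2))).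
pose L := limit_form P V b.
have mL : measurable_fun setT L by exact: measurable_limit_form.
have iL : (gauss_cV m).-integrable setT (EFin \o L).
  apply/integrableP; split; first exact/measurable_EFinP.
  under eq_integral do rewrite /= ger0_norm ?limit_form_ge0//.
  by rewrite integral_limit_form// ltry.
(* The codomain is restated as [measurableTypeR R], the type on which laws on the line live. *)
have mL' : @measurable_fun _ _ 'cV[R]_m (measurableTypeR R) setT L by exact: mL.
pose X : {mfun 'cV[R]_m >-> measurableTypeR R} :=
  HB.pack L (isMeasurableFun.Build _ _ _ _ _ mL').
exists (distribution (gauss_cV m) X); split; last first.
  rewrite /law_mean (integral_distribution (X := X))//.
  by rewrite [LHS]integral_limit_form// costE.
have mtr n : measurable_fun setT (trace_stat I Ys Zs Q alpha n).
  apply: measurable_funM => //; apply: measurable_mxtrace.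
  apply: measurable_mulmx; first exact: measurable_cst_mx.
  apply: measurable_colproj => i j.
  rewrite (funext (fun w => etahatE n w i j)).
  by apply: measurable_funM => //; exact: measurable_iid_sum.
move=> f cf [M fM].
have mf : measurable_fun setT f by exact: continuous_measurable_fun.
have ibd d0 (T0 : measurableType d0) (P0 : probability T0 R) (g : T0 -> R) :
    measurable_fun setT g -> P0.-integrable setT (EFin \o (f \o g)).
  move=> mg; apply: (@integrable_bounded _ _ _ P0 _ M) => [|w]; last exact: fM.
  exact: measurableT_comp.
have E0 : (\int[distribution (gauss_cV m) X]_x (f x)%:E)%E =
    (\int[gauss_cV m]_v f (L v))%:E.
  rewrite (integral_distribution (X := X))//; [|exact/measurable_EFinP|exact: ibd].
  by rewrite /Rintegral fineK//; apply: integrable_fin_num => //; exact: ibd.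
have En n : ('E_P[f \o trace_stat I Ys Zs Q alpha n])%E =
    (\int[P]_w f (trace_stat I Ys Zs Q alpha n w))%:E.
  rewrite unlock /Rintegral fineK//; apply: integrable_fin_num => //; exact: ibd.
rewrite E0 (funext En); apply: cvg_EFin; first exact: nearW.
pose X' n w := dotv (normalized_sum U b n w) (normalized_sum U b n w).
suff cv : \int[P]_w f (trace_stat I Ys Zs Q alpha n.+1 w) @[n --> \oo] -->
    \int[gauss_cV m]_v f (L v).
  rewrite -(cvg_shiftS (fun n => \int[P]_w f (trace_stat I Ys Zs Q alpha n w))).
  exact: cv.
have clt : \int[P]_w f (X' n.+1 w) @[n --> \oo] --> \int[gauss_cV m]_v f (L v).
  rewrite (cvg_shiftS (fun n => \int[P]_w f (X' n w))).
  by apply: vector_clt => //; exists M.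
have [ierr errc] := err_cvg.
have mom n := expectation_normalized_sum mU mV iid mb ib2 ib0 (ltn0Sn n).
have sl := @slutsky_relative _ _ _ P (fun n => trace_stat I Ys Zs Q alpha n.+1)
  (fun n => X' n.+1) (fun n => err n.+1) mean_cost f.
have {}sl : \int[P]_w f (trace_stat I Ys Zs Q alpha n.+1 w) -
    \int[P]_w f (X' n.+1 w) @[n --> \oo] --> (0 : R).
  apply: sl => //.
  - by move=> n w; apply: sumr_ge0 => q _; rewrite -expr2 sqr_ge0.
  - by move=> n; have [] := mom n.
  - by move=> n; rewrite -costE; have [_ ->] := mom n.
  - by move=> n w; apply: sumr_ge0 => i _; apply: sumr_ge0 => j _; exact: sqr_ge0.
  (* A relative bound survives the multiplication of both quantities by n; an absolute one would
     not. *)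
  - move=> e e0; have [r r0 Hr] := trace_colproj_near QT QQ feas e0.
    exists r => // n w /Hr; rewrite /X' -Qetahat /trace_stat -mulrBr normrM normr_nat.
    by move=> h; rewrite mulrCA ler_wpM2l.
  - by exists M.
rewrite -[X in _ --> X]add0r.
rewrite (_ : (fun n => _) = (fun n => (\int[P]_w f (trace_stat I Ys Zs Q alpha n.+1 w) -
    \int[P]_w f (X' n.+1 w)) + \int[P]_w f (X' n.+1 w))).
  exact: cvgD.
by apply/funext => n; rewrite subrK.
Qed.

End trace_statistic_limit.

(** * Slice moments: eta and the mean of the limit in terms of C and D *)

Section slice_moments.
Context d (T : measurableType d) (R : realType) (P : probability T R).
Context (p k H : nat) (Y : T -> R) (Z : T -> 'cV[R]_p).
Context (I : 'I_H -> set R) (Q : 'M[R]_p) (alpha : 'M[R]_(H, k)).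
Hypothesis mY : measurable_fun setT Y.
Hypothesis mZ : measurable_fun setT Z.
Hypothesis mI : forall h, measurable (I h).
Hypothesis Z2 : forall i, P.-integrable setT (EFin \o (fun w => Z w i 0 ^+ 2)).

Let mZi i : measurable_fun setT (fun w => Z w i 0 : R).
Proof. exact: (measurableT_comp (measurable_coord i 0) mZ). Qed.

Let integrable_mul_slice (f : T -> R) h : measurable_fun setT f ->
  P.-integrable setT (EFin \o f) ->
  P.-integrable setT (EFin \o (fun w => f w * \1_(I h) (Y w))).
Proof.
move=> mf; apply: le_integrable => //.
  apply/measurable_EFinP; apply: measurable_funM => //.
  by apply: (measurableT_comp _ mY); exact: measurable_indic.
move=> w _; rewrite /= lee_fin normrM ler_piMr// indicE.
by case: (_ \in _); rewrite ?normr1 ?normr0.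
Qed.

Lemma eta_mxE : eta_mx P I Y Z alpha = slice_C P I Y Z *m alpha.
Proof.
apply/matrixP => i j; rewrite !mxE unlock.
have iZ : P.-integrable setT (EFin \o (fun w => Z w i 0)) by exact: integrable_of_sqr.
rewrite -[LHS]/(\int[P]_w (Z w i 0 * slice_psi I alpha j (Y w))).
under eq_Rintegral do rewrite /slice_psi mulr_sumr.
have it h : P.-integrable setT (EFin \o (fun w => Z w i 0 * (alpha h j * \1_(I h) (Y w)))).
  have := integrableZl measurableT (alpha h j) (integrable_mul_slice h (mZi i) iZ).
  by apply: eq_integrable => // w _; rewrite /= mulrCA.
rewrite Rintegral_sum//; apply: eq_bigr => h _.
under eq_Rintegral do rewrite mulrCA.
rewrite RintegralZl//; last exact: integrable_mul_slice.
by rewrite mulrC mxE unlock.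
Qed.

(** Disjoint slices remove the cross terms from the square of psi, leaving sum_h alpha_(h,j)^2 1_(I
    h). Summing over the coordinates of Q Z then produces the weights of [slice_d]. *)
Lemma slice_mean_cost : trivIset setT I -> (forall h, 0 <= slice_d P I Y Z Q 0 h) ->
  \sum_i \sum_j \int[P]_w (((Q *m Z w) i 0 * slice_psi I alpha j (Y w)) ^+ 2) =
  frob2 (diag_sqrt (slice_d P I Y Z Q) *m alpha).
Proof.
move=> dI dv0.
have psi2 j y : slice_psi I alpha j y ^+ 2 = \sum_h alpha h j ^+ 2 * \1_(I h) y.
  rewrite expr2 /slice_psi big_distrl /=; apply: eq_bigr => h _.
  rewrite big_distrr /= (bigD1 h)//= big1 ?addr0 => [|h' h'h].
    by rewrite !indicE; case: (_ \in _); rewrite ?mulr1 ?mulr0 ?expr2.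
  rewrite !indicE; have [yh|yh] := boolP (y \in I h); last by rewrite mulr0 mul0r.
  have [yh'|yh'] := boolP (y \in I h'); last by rewrite !mulr0.
  move: yh yh'; rewrite !inE => yh yh'.
  by move: h'h; rewrite (dI h' h Logic.I Logic.I) ?eqxx//; exists y.
have mQZ i : measurable_fun setT (fun w => (Q *m Z w) i 0).
  under eq_fun do rewrite mxE.
  by apply: measurable_sum => l; exact: measurable_funM.
have iQZ i : P.-integrable setT (EFin \o (fun w => (Q *m Z w) i 0 ^+ 2)).
  under eq_fun do rewrite mxE.
  apply: integrable_sqr_sum => l; first exact: measurable_funM.
  exact: integrable_sqrZ.
have mQZ2 i : measurable_fun setT (fun w => (Q *m Z w) i 0 ^+ 2).
  exact: measurable_funX.
have isl i h := integrable_mul_slice h (mQZ2 i) (iQZ i).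
transitivity (\sum_i \sum_j \sum_h alpha h j ^+ 2 *
    \int[P]_w ((Q *m Z w) i 0 ^+ 2 * \1_(I h) (Y w))).
  apply: eq_bigr => i _; apply: eq_bigr => j _.
  under eq_Rintegral do rewrite exprMn psi2 mulr_sumr.
  have it h : P.-integrable setT (EFin \o
      (fun w => (Q *m Z w) i 0 ^+ 2 * (alpha h j ^+ 2 * \1_(I h) (Y w)))).
    have := integrableZl measurableT (alpha h j ^+ 2) (isl i h).
    by apply: eq_integrable => // w _; rewrite /= mulrCA.
  rewrite Rintegral_sum//; apply: eq_bigr => h _.
  by under eq_Rintegral do rewrite mulrCA; rewrite RintegralZl.
transitivity (\sum_h \sum_j alpha h j ^+ 2 * slice_d P I Y Z Q 0 h); last first.
  apply: eq_bigr => h _; apply: eq_bigr => j _.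
  move: (slice_d P I Y Z Q) (dv0 h) => v v0.
  by rewrite mul_diag_mx !mxE exprMn sqr_sqrtr// mulrC.
rewrite exchange_big /= [RHS]exchange_big /=; apply: eq_bigr => j _.
rewrite exchange_big /=; apply: eq_bigr => h _; rewrite -mulr_sumr; congr (_ * _).
rewrite mxE expectation.unlock -[RHS]/(\int[P]_w (sqnorm (Q *m Z w) * \1_(I h) (Y w))).
by under [RHS]eq_Rintegral do rewrite /sqnorm mulr_suml; rewrite Rintegral_sum.
Qed.

End slice_moments.

(** Limit laws enter as an arbitrary family [W], so that the minimization concerns every choice of
    limit and not one constructed representative. *)
Theorem proposition5p1 (disp : measure_display) (T : measurableType disp)
    (R : realType) (P : probability T R) (p d H : nat)
    (Y : {RV P >-> R}) (X : {RV P >-> 'cV[R]_p})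
    (* X has an invertible covariance matrix, S = Sigma^{-1/2} *)
    (X2 : forall i, (fun w => X w i 0) \in Lfun P 2%:E)
    (Sigma_unit : cov_mx P X \in unitmx)
    (S : 'M[R]_p) (S_sqrt : is_psd_sqrt (invmx (cov_mx P X)) S)
    (Z : T -> 'cV[R]_p) (ZE : Z = standardize P S X)
    (Zs : nat -> {RV P >-> 'cV[R]_p}) (Ys : nat -> {RV P >-> R})
    (iid : iid_copies P (fun i w => (Zs i w, Ys i w)) (fun w => (Z w, Y w)))
    (X_density : has_density_null_boundary P X)
    (Ec : {vspace 'cV[R]_p}) (Ec_central : is_central_subspace P Y Z Ec)
    (dim_Ec : \dim Ec = d)
    (Qc : 'M[R]_p) (QcE : Qc = 1%:M - orthproj Ec)
    (linearity : linearity_condition P Z (orthproj Ec))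
    (I : 'I_H -> set R)
    (I_measurable : forall h, measurable (I h))
    (I_disjoint : trivIset setT I)
    (I_cover : range Y `<=` \bigcup_h I h)
    (C : 'M[R]_(p, H)) (CE : C = slice_C P I Y Z)
    (dv : 'rV[R]_H) (dvE : dv = slice_d P I Y Z Qc)
    (dv_gt0 : forall h, 0 < dv 0 h)
    (C_span : <<[seq col h C | h <- enum 'I_H]>>%VS = Ec)
    (P1 : 'M[R]_(H, d)) (P2 : 'M[R]_(H, H - d)) (D0 : 'rV[R]_d)
    (P_orth : (row_mx P1 P2)^T *m row_mx P1 P2 = 1%:M /\
              row_mx P1 P2 *m (row_mx P1 P2)^T = 1%:M)
    (D0_neq0 : forall k, D0 0 k != 0)
    (G_diag : (row_mx P1 P2)^T *m slice_G C dv *m row_mx P1 P2 =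
              block_mx (diag_mx D0) 0 0 0) :
  let feasible (alpha : 'M[R]_(H, d)) :=
    (eta_mx P I Y Z alpha)^T *m eta_mx P I Y Z alpha = 1%:M in
  let is_limit_law alpha W := cvg_in_law P (trace_stat I Ys Zs Qc alpha) W in
  (forall alpha, feasible alpha -> exists W, is_limit_law alpha W) /\
  (forall W : 'M[R]_(H, d) -> probability (measurableTypeR R) R,
    (forall alpha, feasible alpha -> is_limit_law alpha (W alpha)) ->
    forall alpha,
      (feasible alpha /\
       forall beta, feasible beta ->
         (law_mean (W alpha) <= law_mean (W beta))%E) <->
      exists O : 'M[R]_d, orthogonal_mx O /\
        alpha = diag_invsqrt dv *m P1 *m diag_invsqrt D0 *m O).

Proof.
move=> feasible is_limit_law.
have mY : measurable_fun setT Y by [].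
have mYs i : measurable_fun setT (Ys i) by [].
have mZs i : measurable_fun setT (Zs i) by [].
have mX : measurable_fun setT X by [].
have mXi i : measurable_fun setT (fun w => X w i 0 : R).
  exact: (measurableT_comp (measurable_coord i 0) mX).
have ZiE i w : Z w i 0 = \sum_l S i l * (X w l 0 + - mean_cV P X l 0).
  by rewrite ZE /standardize mxE; apply: eq_bigr => l _; rewrite !mxE.
have mZ : measurable_fun setT Z.
  apply: measurable_fun_mx => i j; rewrite (ord1 j).
  rewrite (funext (ZiE i)); apply: measurable_sum => l.
  by apply: measurable_funM => //; exact: measurable_funD.
have icst (r : R) : P.-integrable setT (EFin \o (fun=> r)).
  by apply: (@integrable_bounded _ _ _ P _ `|r|).
(* Each coordinate of Z is a linear combination of centred coordinates of X, which are square
   integrable. *)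
have Z2 i : P.-integrable setT (EFin \o (fun w => Z w i 0 ^+ 2)).
  under eq_fun do rewrite ZiE.
  apply: integrable_sqr_sum => l.
    by apply: measurable_funM => //; exact: measurable_funD.
  apply: integrable_sqrZ; apply: integrable_sqrD => //.
  have /Lfun1_integrable := Lfun2_mul_Lfun1 (X2 l) (X2 l).
  by apply: eq_integrable.
have [OT OO Oin] := orthprojP Ec.
have QT : Qc^T = Qc by rewrite QcE linearB /= trmx1 OT.
have QQ : Qc *m Qc = Qc.
  by rewrite QcE mulmxBl mul1mx mulmxBr mulmx1 OO subrr subr0.
(* The columns of C belong to their span [Ec], which [orthproj Ec] fixes; this is what makes Q_c eta
   = Q_c C alpha vanish. *)
have QC : Qc *m C = 0.
  apply/matrixP => i h; rewrite [RHS]mxE.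
  have : col h C \in Ec by rewrite -C_span memv_span//; apply: map_f; rewrite mem_enum.
  rewrite Oin => /eqP Oc.
  have : (Qc *m col h C) i 0 = 0 by rewrite QcE mulmxBl mul1mx Oc subrr mxE.
  by rewrite colE mulmxA -colE mxE.
have etaE alpha : eta_mx P I Y Z alpha = C *m alpha by rewrite CE eta_mxE.
have dv_ge0 h : 0 <= slice_d P I Y Z Qc 0 h by rewrite -dvE ltW.
have limit alpha : feasible alpha -> exists W, is_limit_law alpha W /\
    law_mean W = (frob2 (diag_sqrt dv *m alpha))%:E.
  move=> fa; rewrite dvE -slice_mean_cost//.
  apply: trace_stat_cvg_in_law => //.
  by rewrite etaE mulmxA QC mul0mx.
split=> [alpha /limit[W [lW _]]|W limW]; first by exists W.
(* The given law and the constructed one are limits of the same expectations, so they agree on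
   bounded continuous functions and have the same mean. *)
have meanW alpha : feasible alpha ->
    law_mean (W alpha) = (frob2 (diag_sqrt dv *m alpha))%:E.
  move=> fa; have [W0 [lW0 <-]] := limit _ fa.
  apply: eq_law_mean => f cf fb.
  exact: (cvg_unique _ (limW _ fa f cf fb) (lW0 f cf fb)).
have feasE alpha : feasible alpha <-> (C *m alpha)^T *m (C *m alpha) = 1%:M.
  by rewrite /feasible etaE.
move=> alpha.
have main := slice_minimization dv_gt0 P_orth D0_neq0 G_diag alpha.
split=> [[fa amin]|sol].
  apply/main; split; first exact/feasE.
  move=> beta /feasE fb; have := amin _ fb.
  by rewrite (meanW _ fa) (meanW _ fb) lee_fin.
have [/feasE fa amin] := main.2 sol; split=> // beta fb.
rewrite (meanW _ fa) (meanW _ fb) lee_fin; apply: amin; exact/feasE.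
Qed.
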